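(* Let $\mathcal{C}$ be a class of finite groups closed under subgroups, quotients and extensions. Let $(\mathcal{G},\Gamma)$ be a finite commensurating graph of pro-$\mathcal{C}$ groups, with vertex set $V$ and fundamental pro-$\mathcal{C}$ group $\Pi$. The following are equivalent: (i) $(\mathcal{G},\Gamma)$ is tame (and, in particular, injective); (ii) there exist a pro-$\mathcal{C}$ group $Q$ and a continuous homomorphism $\psi:\Pi\to Q$ such that for every $v\in V$, $\psi|_{\mathcal{G}(v)}$ is injective and $\psi(\mathcal{G}(v))$ is open in $Q$.
   Context: A graph $\Gamma$ is a set that is a disjoint union of a vertex set $V$ and an edge set $E$, with maps $d_0,d_1:\Gamma\to V$ restricting to the identity on $V$. A finite graph of pro-$\mathcal{C}$ groups $(\mathcal{G},\Gamma)$ over a finite graph $\Gamma$ consists of pro-$\mathcal{C}$ groups (inverse limits of groups in $\mathcal{C}$) $\mathcal{G}(m)$ for each $m\in\Gamma$ and continuous monomorphisms $\partial_i:\mathcal{G}(e)\to\mathcal{G}(d_i(e))$ for $e\in E$, $i=0,1$. It is commensurating if $\Gamma$ is connected and $\partial_i(\mathcal{G}(e))$ is open in $\mathcal{G}(d_i(e))$ for all $e\in E$, $i=0,1$. Fix a maximal subtree $T$ of $\Gamma$. The fundamental pro-$\mathcal{C}$ group $\Pi=\Pi_1^{\mathcal{C}}(\mathcal{G},\Gamma)$ is the quotient of the free pro-$\mathcal{C}$ product $F_{\mathcal{C}}\amalg\coprod_{v\in V}\mathcal{G}(v)$, where $F_{\mathcal{C}}$ is the free pro-$\mathcal{C}$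 group with basis $\{t_e: e\in E\}$, by the closed normal subgroup generated by $\{t_e: e\in E\cap T\}\cup\{\partial_0(g)^{-1}t_e\partial_1(g)t_e^{-1}: g\in\mathcal{G}(e), e\in E\}$; up to isomorphism it does not depend on $T$. There are natural homomorphisms $\varphi_v:\mathcal{G}(v)\to\Pi$; in (ii), $\psi|_{\mathcal{G}(v)}$ and $\psi(\mathcal{G}(v))$ mean $\psi\circ\varphi_v$ and its image. $(\mathcal{G},\Gamma)$ is injective if every $\varphi_v$ is injective, in which case each $\mathcal{G}(v)$ is identified with its image in $\Pi$, and each edge group $\mathcal{G}(e)$ with a subgroup of $\Pi$ via $\partial_0$ (or, up to conjugation by $t_e$, via $\partial_1$). A finite commensurating graph of pro-$\mathcal{C}$ groups is tame if it is injective and there is a closed normal subgroup $N$ of $\Pi$ such that $N$ is contained as an open subgroup in each vertex group and each edge group, and the image of $\Pi$ in $\operatorname{Out}N$ (continuous automorphisms modulo inner ones) induced by conjugation is finite. *)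

(* Defs.v *)
From HB Require Import structures.
From mathcomp Require Import all_boot all_fingroup.
From mathcomp Require Import all_classical topology.

Set Implicit Arguments.
Unset Strict Implicit.
Unset Printing Implicit Defensive.

Local Open Scope group_scope.
Local Open Scope classical_set_scope.

(* ** Topological groups *)

HB.mixin Record isTopologicalGroup G of monoid.Group G & Topological G := {
  mulg_continuous : continuous (fun xy : G * G => xy.1 * xy.2);
  invg_continuous : continuous (fun x : G => x^-1)
}.

#[short(type="topGroupType")]
HB.structure Definition TopGroup :=
  {G of monoid.Group G & Topological G & isTopologicalGroup G}.

Definition continuous_hom (G H : topGroupType) (f : G -> H) : Prop :=
  {morph f : x y / x * y} /\ continuous f.

(* ** Classes of finite groups and pro-C groups *)

Definition finite_group_class := forall gT : finGroupType, {group gT} -> Prop.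

(* Invariance under isomorphism is part of the notion of a class of groups. *)
Record closed_class (C : finite_group_class) : Prop := ClosedClass {
  class_isog : forall (gT rT : finGroupType) (G : {group gT}) (H : {group rT}),
    G \isog H -> C gT G -> C rT H;
  class_sub : forall (gT : finGroupType) (H G : {group gT}),
    H \subset G -> C gT G -> C gT H;
  class_quo : forall (gT : finGroupType) (H G : {group gT}),
    H <| G -> C gT G -> C (coset_of H) (G / H)%G;
  class_ext : forall (gT : finGroupType) (H G : {group gT}),
    H <| G -> C gT H -> C (coset_of H) (G / H)%G -> C gT G
}.

Record inverse_system := InverseSystem {
  is_index : eqType;
  is_le : is_index -> is_index -> Prop;
  is_refl : forall i, is_le i i;
  is_anti : forall i j, is_le i j -> is_le j i -> i = j;
  is_trans : forall i j k, is_le i j -> is_le j k -> is_le i k;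
  is_inhabited : exists i : is_index, True;
  is_directed : forall i j, exists k, is_le i k /\ is_le j k;
  is_obj : is_index -> finGroupType;
  is_map : forall i j, is_le i j -> is_obj j -> is_obj i;
  is_map_hom : forall i j (ij : is_le i j), {morph is_map ij : x y / x * y};
  is_map_id : forall i (ii : is_le i i) x, is_map ii x = x;
  is_map_comp : forall i j k (ij : is_le i j) (jk : is_le j k) (ik : is_le i k)
    x, is_map ij (is_map jk x) = is_map ik x
}.

Definition is_product (S : inverse_system) : topologicalType :=
  prod_topology (fun i : is_index S => discrete_topology (is_obj i)).

Definition threads (S : inverse_system) : set (is_product S) :=
  [set x | forall i j (ij : is_le i j), is_map ij (x j : is_obj j) = x i].

(* G is identified by p, algebraically and topologically, with the subgroup of
   threads of the product of the discrete groups of the system. *)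
Record is_inverse_limit (S : inverse_system) (G : topGroupType)
    (p : G -> is_product S) : Prop := IsInverseLimit {
  lim_hom : forall i x y,
    p (x * y) i = (p x i : is_obj i) * (p y i : is_obj i) :> is_obj i;
  lim_inj : injective p;
  lim_range : range p = threads (S := S);
  lim_open : forall U : set G,
    open U <-> exists2 W : set (is_product S), open W & U = p @^-1` W
}.

Definition pro_class (C : finite_group_class) (G : topGroupType) : Prop :=
  exists S : inverse_system,
    (forall i : is_index S, C (is_obj i) [set: is_obj i]%G) /\
    exists p : G -> is_product S, is_inverse_limit p.

(* ** Closed normal subgroups, quotients, outer automorphisms *)

Record closed_normal_subgroup (G : topGroupType) := ClosedNormalSubgroup {
  cns_set :> set G;
  cns1 : cns_set 1;
  cnsM : forall x y, cns_set x -> cns_set y -> cns_set (x * y);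
  cnsV : forall x, cns_set x -> cns_set x^-1;
  cnsJ : forall g x, cns_set x -> cns_set (g * x * g^-1);
  cns_closed : closed cns_set
}.

Definition closed_normal_closure (G : topGroupType) (S : set G) : set G :=
  [set x | forall N : closed_normal_subgroup G, S `<=` N -> cns_set N x].

Record is_quotient_map (P Q : topGroupType) (K : set P) (q : P -> Q) : Prop :=
  IsQuotientMap {
  quo_hom : continuous_hom q;
  quo_surj : forall y, exists x, q x = y;
  quo_ker : forall x, q x = 1 <-> K x;
  quo_open : forall U : set Q, open (q @^-1` U) -> open U
}.

Section OuterAutomorphisms.
Variables (G : topGroupType) (N : closed_normal_subgroup G).

(* N as a type is the subtype of elements of N, with the induced topology. *)
Definition conj_on (g : G) (x : N) : N :=
  exist _ (g * val x * g^-1) (mem_set (cnsJ g (set_mem (valP x)))).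

Definition continuous_aut : set (N -> N) :=
  [set f : N -> N | [/\ forall x y z : N, val z = val x * val y ->
                 val (f z) = val (f x) * val (f y),
               continuous f
             & exists f' : N -> N,
                 [/\ cancel f f', cancel f' f & continuous f']]].

(* The class of f in Out N: its coset modulo the inner automorphisms. *)
Definition outer_class (f : N -> N) : set (N -> N) :=
  [set h | continuous_aut h /\
     exists2 n : G, cns_set N n & forall x, h x = f (conj_on n x)].

Definition image_in_Out : set (set (N -> N)) :=
  range (fun g : G => outer_class (conj_on g)).

End OuterAutomorphisms.

(* ** Graphs *)

(* The graph is the disjoint union of vert and edge; endpoint false and
   endpoint true are the restrictions to edges of the maps d_0 and d_1, which
   are the identity on vertices. *)
Record finite_graph := FiniteGraph {
  vert : finType;
  edge : finType;
  endpoint : bool -> edge -> vert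
}.

Record subgraph (X : finite_graph) := Subgraph {
  sub_vert : {set vert X};
  sub_edge : {set edge X};
  sub_closed : forall i e, e \in sub_edge -> endpoint i e \in sub_vert
}.

Definition full_subgraph (X : finite_graph) : subgraph X :=
  @Subgraph X [set: vert X]%SET [set: edge X]%SET (fun _ _ _ => finset.in_setT _).

Definition adjacent (X : finite_graph) (S : subgraph X) : rel (vert X) :=
  fun x y => [exists e in sub_edge S, exists i,
                (endpoint i e == x) && (endpoint (~~ i) e == y)].

Definition subgraph_connected (X : finite_graph) (S : subgraph X) : Prop :=
  sub_vert S != finset.set0 /\
  {in sub_vert S &, forall x y, connect (adjacent S) x y}.

Definition graph_connected (X : finite_graph) : Prop :=
  subgraph_connected (full_subgraph X).

(* The oriented edge (e, i) runs from d_i(e) to d_(1-i)(e). *)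
Definition origin (X : finite_graph) (a : edge X * bool) := endpoint a.2 a.1.
Definition terminus (X : finite_graph) (a : edge X * bool) := endpoint (~~ a.2) a.1.

(* A loop is a circuit of length 1, a pair of parallel edges one of length 2;
   going back and forth along one edge is not a circuit. *)
Definition circuit (X : finite_graph) (c : seq (edge X * bool)) : bool :=
  [&& c != [::], path.cycle (fun a b => terminus a == origin b) c,
      uniq [seq a.1 | a <- c] & uniq [seq origin a | a <- c]].

Definition subtree (X : finite_graph) (S : subgraph X) : Prop :=
  subgraph_connected S /\
  forall c, circuit c -> ~~ all (fun a => a.1 \in sub_edge S) c.

Definition maximal_subtree (X : finite_graph) (T : subgraph X) : Prop :=
  subtree T /\
  forall S : subgraph X, subtree S ->
    sub_vert T \subset sub_vert S -> sub_edge T \subset sub_edge S ->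
    sub_vert S = sub_vert T /\ sub_edge S = sub_edge T.

(* ** Graphs of pro-C groups *)

Record proC_graph (C : finite_group_class) (X : finite_graph) := ProCGraph {
  vgroup : vert X -> topGroupType;
  egroup : edge X -> topGroupType;
  bd : forall (i : bool) (e : edge X), egroup e -> vgroup (endpoint i e);
  vgroup_proC : forall v, pro_class C (vgroup v);
  egroup_proC : forall e, pro_class C (egroup e);
  bd_hom : forall i e, continuous_hom (@bd i e);
  bd_inj : forall i e, injective (@bd i e)
}.

Definition commensurating (C : finite_group_class) (X : finite_graph)
    (A : proC_graph C X) : Prop :=
  graph_connected X /\ forall i (e : edge X), open (range (@bd C X A i e)).

(* ** Free pro-C groups and products, the fundamental pro-C group *)

Definition free_proC (C : finite_group_class) (X : finType)
    (F : topGroupType) (t : X -> F) : Prop :=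
  pro_class C F /\
  forall H : topGroupType, pro_class C H -> forall h : X -> H,
    exists! f : F -> H, continuous_hom f /\ forall x, f (t x) = h x.

Definition free_proC_product (C : finite_group_class) (I : finType)
    (A : I -> topGroupType) (P : topGroupType) (inj : forall i, A i -> P)
    : Prop :=
  [/\ pro_class C P,
      forall i, continuous_hom (@inj i)
    & forall H : topGroupType, pro_class C H ->
      forall h : (forall i, A i -> H), (forall i, continuous_hom (@h i)) ->
      exists! f : P -> H, continuous_hom f /\ forall i a, f (inj i a) = h i a].

Section FundamentalGroup.
Variables (C : finite_group_class) (X : finite_graph) (A : proC_graph C X).

(* The factors of the free product: F for None and the vertex groups. *)
Definition factors (F : topGroupType) (o : option (vert X)) : topGroupType :=
  if o is Some v then vgroup A v else F.

Definition relators (T : subgraph X) (P : topGroupType) (t : edge X -> P)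
    (inj : forall v, vgroup A v -> P) : set P :=
  [set t e | e in [set e | e \in sub_edge T]] `|`
  [set r | exists e (g : egroup A e),
     r = (inj _ (bd false g))^-1 * t e * inj _ (bd true g) * (t e)^-1].

(* Free pro-C groups and products are given by their universal properties, so
   this is the type of all models of the fundamental group, each of them with
   the data it is built from. *)
Record fundamental_group (T : subgraph X) := FundamentalGroup {
  fg_free : topGroupType;
  fg_basis : edge X -> fg_free;
  fg_freeP : free_proC C fg_basis;
  fg_prod : topGroupType;
  fg_inj : forall o, factors fg_free o -> fg_prod;
  fg_prodP : free_proC_product C fg_inj;
  fg_group :> topGroupType;
  fg_quo : fg_prod -> fg_group;
  fg_quoP : is_quotient_map
    (closed_normal_closure
       (relators T (fun e => fg_inj (o := None) (fg_basis e))
                   (fun v => fg_inj (o := Some v))))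
    fg_quo
}.

Variables (T : subgraph X) (Pi : fundamental_group T).

Definition phi (v : vert X) (g : vgroup A v) : Pi :=
  fg_quo (@fg_inj T Pi (Some v) g).

Definition edge_embedding (e : edge X) (g : egroup A e) : Pi :=
  phi (bd false g).

Definition injective_graph : Prop := forall v, injective (@phi v).

(* N is contained, as an open subgroup, in the group K identified with its image
   under the injection f: K carries its own topology. *)
Definition open_subgroup_via (K : topGroupType) (f : K -> Pi) (N : set Pi) :=
  N `<=` range f /\ open (f @^-1` N).

Definition tame : Prop :=
  injective_graph /\
  exists N : closed_normal_subgroup Pi,
    [/\ forall v, open_subgroup_via (@phi v) N,
        forall e, open_subgroup_via (@edge_embedding e) N
      & finite_set (@image_in_Out Pi N)].

End FundamentalGroup.

(* Main.v *)
(** (ii) => (i): choose an open normal subgroup V of Q inside the images of all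
    vertex and edge groups, and let N be the preimage of V in a vertex group.
    Along the tree T, and up to conjugation by t_e in general, this preimage
    does not depend on the vertex, so N is normal in Pi; psi identifies the
    action of Pi on N with that of psi(Pi) on V, whose outer image is a quotient
    of the finite group Q/V.

    (i) => (ii): there is an open normal subgroup L of Pi that contains N, meets
    every vertex group inside N, and is the product of N and D = L /\ C(N).  Put
    P = Pi/L and Z = N /\ D, which is central in L.  As the finite groups
    G(v)/N act freely on P, the universal property of Pi yields a homomorphism
    from Pi to the wreath product of Pi by P that kills N; its coordinates split
    L -> L/N by a Pi-equivariant family of homomorphisms s_b : L -> D (b in P)
    with s_b(l) in N l.  Hence w |-> w s_b(w)^-1 retracts D onto Z.  The s_b
    differ by homomorphisms into Z, and averaging these over P gives a closed
    normal subgroup W of Pi, contained in D, such that NW has finite index.  The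
    group W /\ N consists of k-torsion elements, k = |P|, of a finitely generated
    abelian profinite group, hence is finite.  Cutting W down by an open normal
    subgroup avoiding the nontrivial ones gives D' with D' /\ N = 1 and N D' open,
    and Q = Pi/D' works. *)

Require Import Defs.
From HB Require Import structures.
From mathcomp Require Import all_boot all_fingroup.
From mathcomp Require Import cyclic.
From mathcomp Require Import all_classical topology.

Set Implicit Arguments.
Unset Strict Implicit.
Unset Printing Implicit Defensive.

Local Open Scope group_scope.
Local Open Scope classical_set_scope.

(** * Topological groups and homomorphisms to finite groups *)

(** The obvious candidate for [Q], the quotient of [Pi] by [D], fails because [D] meets [N] in [Z],
    which may be infinite. One splitting would already yield a complement of [Z] in [D], but not a
    normal one: conjugation by [g] turns [s b] into [s (q g * b)]. This forces the whole family
    indexed by [P], and the averaging. Division by [k] need not be possible in [Z], so the mean is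
    replaced by a product over [P], at the price of passing to [k]-th powers; hence the [k]-torsion
    and the appeal to finite generation. The wreath product enters because an extension pulled back
    to functions on [P] splits over every group that acts freely on [P]. The images of the vertex
    and edge groups in [P] act freely by translation, and the graph glues the resulting splittings.
    The universal property of [Pi] speaks of pro-C targets only, so the wreath product has to be
    pro-C; closure under extensions is used there. Pro-C groups are handled throughout as compact
    groups in which the kernels of homomorphisms to finite groups of the class form a basis at 1. *)

Section Morphisms.
Variables (G H : groupType) (f : G -> H).
Hypothesis fM : {morph f : x y / x * y}.

Lemma hom1 : f 1 = 1.
Proof. by apply: (@mulIg _ (f 1)); rewrite -fM !mul1g. Qed.

Lemma homV x : f x^-1 = (f x)^-1.
Proof. by apply: (@mulIg _ (f x)); rewrite -fM !mulVg hom1. Qed.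

Lemma homX x n : f (x ^+ n) = f x ^+ n.
Proof. by elim: n => [|n IH]; rewrite ?expg0 ?hom1 // !expgS fM IH. Qed.

Lemma hom_eq x y : f x = f y <-> f (x^-1 * y) = 1.
Proof.
rewrite fM homV; split=> [->|e]; first by rewrite mulVg.
by rewrite -[f y](mulKVg (f x)) e mulg1.
Qed.

End Morphisms.

Section TopGroups.
Variable G : topGroupType.

Lemma continuous_mul (X : topologicalType) (f g : X -> G) :
  continuous f -> continuous g -> continuous (fun x => f x * g x).
Proof.
move=> cf cg x.
apply: (@continuous2_cvg _ _ _ _ _ _ f g (fun a b => a * b) (f x) (g x)).
- exact: (@mulg_continuous G (f x, g x)).
- exact: cf.
- exact: cg.
Qed.

Lemma continuous_inv (X : topologicalType) (f : X -> G) :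
  continuous f -> continuous (fun x => (f x)^-1).
Proof.
by move=> cf x; apply: (continuous_comp (cf x)); exact: invg_continuous.
Qed.

Lemma continuous_idfun (X : topologicalType) : continuous (fun x : X => x).
Proof. by move=> x; exact: cvg_id. Qed.

Lemma continuous_lmul (a : G) : continuous (fun x : G => a * x).
Proof. by apply: continuous_mul; [exact: cst_continuous | exact: continuous_idfun]. Qed.

Lemma continuous_rmul (a : G) : continuous (fun x : G => x * a).
Proof. by apply: continuous_mul; [exact: continuous_idfun | exact: cst_continuous]. Qed.

End TopGroups.

Arguments continuous_lmul {G} a.
Arguments continuous_rmul {G} a.

Lemma open_preimage (X Y : topologicalType) (f : X -> Y) (A : set Y) :
  continuous f -> open A -> open (f @^-1` A).
Proof. by move=> /continuousP; apply. Qed.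

Lemma closed_preimage (X Y : topologicalType) (f : X -> Y) (A : set Y) :
  continuous f -> closed A -> closed (f @^-1` A).
Proof. by move=> /continuous_closedP; apply. Qed.

(** The traces of the [F i] on [A] generate a proper filter; a cluster point of it in [A] lies in
    every [F i], these being closed. *)
Lemma compact_directed (X : topologicalType) (A : set X) (I : Type)
    (F : I -> set X) :
  compact A -> inhabited I -> (forall i, closed (F i)) ->
  (forall i j, exists k, F k `<=` F i `&` F j) ->
  (forall i, (A `&` F i) !=set0) ->
  exists2 x, A x & forall i, F i x.
Proof.
move=> cA [i0] cF dF nF.
pose FF : set_system X := filter_from [set: I] (fun i => A `&` F i).
have pF : ProperFilter FF.
  apply: filter_from_proper; last by move=> i _; exact: nF.
  apply: filter_from_filter; first by exists i0.
  move=> i j _ _; have [k kij] := dF i j; exists k => // x [Ax /kij[? ?]].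
  by split.
have [|x [Ax clx]] := cA FF pF; first by exists i0 => // x [].
exists x => // i; apply: cF => U nU; apply: clx nU.
by exists i => // y [].
Qed.

(** An open kernel amounts to continuity into the discrete group [H]. Surjectivity is not demanded,
    so that homomorphisms can be paired freely; [finite_hom_surj] restores it. *)
Definition finite_hom (C : finite_group_class) (G : topGroupType)
    (H : finGroupType) (f : G -> H) : Prop :=
  [/\ {morph f : x y / x * y}, open (f @^-1` [set 1]) & C H [set: H]%G].

(** Intrinsic form of [pro_class], without an inverse system. Quotients and wreath products are
    shown to be pro-C through it. *)
Definition residually_class (C : finite_group_class) (G : topGroupType) : Prop :=
  [/\ compact [set: G], closed [set (1 : G)] &
    forall W : set G, open W -> W 1 ->
      exists (H : finGroupType) (f : G -> H),
        finite_hom C f /\ forall x, f x = 1 -> W x].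

Section FiniteHoms.
Variables (C : finite_group_class) (hC : closed_class C).

Lemma class_prod (H K : finGroupType) :
  C [set: H]%G -> C [set: K]%G -> C [set: (H * K)%type]%G.
Proof.
move=> CH CK.
have gM : {in [set: (H * K)%type]%SET &, {morph @snd H K : x y / x * y}} by [].
pose fm := Morphism gM.
have iH : {in [set: H]%SET &, {morph (fun x : H => (x, 1 : K)) : x y / x * y}}.
  by move=> x y _ _; congr pair; rewrite mul1g.
pose im := Morphism iH.
have ker_im : 'ker fm = im @* [set: H]%SET.
  apply/setP => -[a b]; apply/idP/idP.
    move/mker => /= ->.
    exact: (mem_morphim im (finset.in_setT a) (finset.in_setT a)).
  case/morphimP => x _ _ [-> ->]; apply/kerP => //; exact: finset.in_setT.
apply: (class_ext hC (ker_normal fm)).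
  have inj : 'injm im by apply/injmP => x y _ _ [].
  have := class_isog hC (sub_isog (finset.subsetT _) inj) CH.
  by rewrite (_ : (im @* [set: H])%G = 'ker fm :> {group _}) //; apply/val_inj.
apply: (class_isog hC) CK.
rewrite isog_sym; apply: isog_trans (first_isog fm) _.
suff -> : [set: K]%G = (fm @* [set: (H * K)%type])%G by exact: isog_refl.
apply/val_inj/esym/setP => b; rewrite finset.in_setT.
exact: (mem_morphim fm (finset.in_setT (1 : H, b)) (finset.in_setT _)).
Qed.

Lemma finite_hom_open (G : topGroupType) (H : finGroupType) (f : G -> H)
  (A : set H) : finite_hom C f -> open (f @^-1` A).
Proof.
case=> fM fo _; rewrite openE => x /= Ax.
rewrite /interior nbhsE; exists [set y | f (x^-1 * y) = 1].
  split; last by rewrite /= mulVg (hom1 fM).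
  exact: (open_preimage (continuous_lmul x^-1) fo).
by move=> y /= /(hom_eq fM) <-.
Qed.

Lemma finite_hom_closed (G : topGroupType) (H : finGroupType) (f : G -> H)
  (A : set H) : finite_hom C f -> closed (f @^-1` A).
Proof.
move=> hf; rewrite -[A]setCK preimage_setC closedC.
exact: (@finite_hom_open _ _ _ (~` A) hf).
Qed.

Lemma finite_hom_pair (G : topGroupType) (H K : finGroupType) (f : G -> H)
    (g : G -> K) : finite_hom C f -> finite_hom C g ->
  finite_hom C (fun x => (f x, g x)).
Proof.
move=> hf hg; have [fM fo fC] := hf; have [gM go gC] := hg; split.
- by move=> x y; rewrite fM gM.
- rewrite (_ : _ @^-1` _ = f @^-1` [set 1] `&` g @^-1` [set 1]); first exact: openI.
  by apply/seteqP; split=> x /= => [[-> ->]|[-> ->]].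
- exact: class_prod.
Qed.

Lemma finite_hom_surj (G : topGroupType) (H : finGroupType) (f : G -> H) :
  finite_hom C f ->
  exists (K : finGroupType) (g : G -> K),
    [/\ finite_hom C g, forall y, exists x, g x = y
      & forall x, g x = 1 <-> f x = 1].
Proof.
case=> fM fo fC.
have gA : group_set [set y : H | `[<exists x, f x = y>]]%SET.
  apply/group_setP; split; first by rewrite finset.inE; apply/asboolP; exists 1; rewrite (hom1 fM).
  move=> a b; rewrite !finset.inE => /asboolP[x <-] /asboolP[y <-].
  by apply/asboolP; exists (x * y).
pose A := Group gA.
have fA x : f x \in A by rewrite finset.inE; apply/asboolP; exists x.
pose g x : subg_of A := Subg (fA x).
have g1 x : g x = 1 <-> f x = 1.
  split=> [/(congr1 val)//|fx]; exact/val_inj.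
exists (subg_of A), g; split=> //; last first.
  case=> y yA; have := yA; rewrite [in X in X -> _]finset.inE => /asboolP[x fx].
  by exists x; apply/val_inj.
split.
- by move=> x y; apply/val_inj; rewrite /= fM.
- rewrite (_ : _ @^-1` _ = f @^-1` [set 1]) //.
  by apply/seteqP; split=> x /= /g1.
- apply: (class_isog hC (isog_subg A)).
  by apply: (class_sub hC) fC; exact: finset.subsetT.
Qed.

Lemma finite_hom_seq (G : topGroupType) (I : eqType) (s : seq I)
    (K : I -> finGroupType) (g : forall i, G -> K i) :
  (exists (H : finGroupType) (f : G -> H), finite_hom C f) ->
  (forall i, finite_hom C (g i)) ->
  exists (H : finGroupType) (f : G -> H),
    finite_hom C f /\ forall x, f x = 1 -> forall i, i \in s -> g i x = 1.
Proof.
move=> [H0 [f0 hf0]] hg; elim: s => [|i s [H [f [hf fs]]]].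
  by exists H0, f0.
exists (K i * H)%type, (fun x => (g i x, f x)); split.
  exact: finite_hom_pair.
by move=> x [gi /fs fx] j; rewrite inE => /predU1P[->//|]; exact: fx.
Qed.

(** If no kernel fitted into [W], every finite intersection of the kernels of the separating maps
    would meet the compact complement of [W]. A common point of all these traces would be a
    nontrivial element that no separating map detects. *)
Lemma residually_class_sep (G : topGroupType) :
  compact [set: G] ->
  (exists (H : finGroupType) (f : G -> H), finite_hom C f) ->
  (forall x : G, x <> 1 ->
    exists (H : finGroupType) (f : G -> H), finite_hom C f /\ f x <> 1) ->
  residually_class C G.
Proof.
move=> cG ex0 sep.
pose J := {x : G | x <> 1}.
pose K (j : J) := projT1 (cid (sep _ (projT2 j))).
pose g (j : J) : G -> K j := projT1 (cid (projT2 (cid (sep _ (projT2 j))))).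
have gP (j : J) : finite_hom C (g j) /\ g j (projT1 j) <> 1.
  exact: (projT2 (cid (projT2 (cid (sep _ (projT2 j)))))).
split=> //.
  rewrite -[X in closed X]setCK closedC.
  rewrite (_ : ~` _ = \bigcup_(j : J) (g j @^-1` [set y | y <> 1])).
    by apply: bigcup_open => j _; exact: (@finite_hom_open _ _ _ [set y | y <> 1] (gP j).1).
  apply/seteqP; split=> [x /= x1|x [j _ /= gx] /= x1].
    by exists (exist _ x x1) => //; exact: (gP (exist _ x x1)).2.
  by apply: gx; rewrite x1; apply: hom1; case: (gP j).1.
move=> W oW W1.
have cW : compact (~` W).
  by apply: (subclosed_compact _ cG) => //; exact: open_closedC.
apply: contrapT => nW.
have [x Wx gx] : exists2 x, (~` W) x &
    forall s : seq {classic J}, forall j, j \in s -> g j x = 1.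
  apply: (@compact_directed _ _ _
    (fun s : seq {classic J} => [set x | forall j, j \in s -> g j x = 1])) => //.
  - exact: (inhabits [::]).
  - move=> s; rewrite (_ : mkset _ =
      \bigcap_(j in [set j : {classic J} | j \in s]) (g j @^-1` [set 1])).
      by apply: closed_bigI => j _; exact: (@finite_hom_closed _ _ _ [set 1] (gP j).1).
    by apply/seteqP; split=> x /= gx j; exact: gx.
  - move=> s t; exists (s ++ t) => x gx; split=> j js; apply: gx;
      by rewrite mem_cat js ?orbT.
  - move=> s; apply: contrapT => nx; apply: nW.
    have [H [f [hf fs]]] := finite_hom_seq (I := {classic J}) s ex0 (fun j => (gP j).1).
    exists H, f; split=> // x fx; apply: contrapT => Wx; apply: nx.
    by exists x; split=> // j; exact: (fs _ fx).
have x1 : x <> 1 by move=> x1; apply: Wx; rewrite x1.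
have [_] := gP (exist _ x x1); apply.
by apply: (gx [:: (exist _ x x1 : {classic J})]); rewrite inE.
Qed.

End FiniteHoms.

(** * Pro-C groups are the compact residually C groups *)

Lemma continuous_prod (X : topologicalType) (I : Type)
    (T : I -> topologicalType) (f : X -> prod_topology T) :
  (forall i, continuous (fun x => f x i)) -> continuous f.
Proof.
move=> cf x; apply/cvg_sup => i U [V [[A oA <-] /= Ax] VU].
apply: filterS VU _; apply: (cf i x A).
by rewrite nbhsE; exists A.
Qed.

Section ProClass.
Variables (C : finite_group_class) (hC : closed_class C).

Lemma open_coordinate (S : inverse_system) (i : is_index S) (A : set (is_obj i)) :
  open [set x : is_product S | A (x i)].
Proof.
have c : continuous (fun x : is_product S => x i : discrete_topology (is_obj i)).
  exact: (@proj_continuous (is_index S) (fun i => discrete_topology (is_obj i)) i).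
apply: (open_preimage (A := A : set (discrete_topology (is_obj i))) c).
exact: discrete_open.
Qed.

Lemma closed_threads (S : inverse_system) : closed (threads (S := S)).
Proof.
rewrite (_ : threads (S := S) = \bigcap_p \bigcap_q \bigcap_pq
    [set x : is_product S | @is_map S p q pq (x q) = x p]).
  apply: closed_bigI => i _; apply: closed_bigI => j _; apply: closed_bigI => ij _.
  rewrite -[X in closed X]setCK closedC.
  rewrite (_ : ~` _ = \bigcup_(a : is_obj j)
     ([set x | x j = a] `&` [set x | x i <> is_map ij a])).
    apply: bigcup_open => a _; apply: openI.
      exact: (@open_coordinate S j [set a]).
    exact: (@open_coordinate S i [set b | b <> is_map ij a]).
  apply/seteqP; split=> [x /= xij|x [a _ [/= xj xi]]] /=.
    by exists (x j) => //; split=> //= e; apply: xij; rewrite e.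
  by rewrite xj => e; apply: xi; rewrite e.
apply/seteqP; split=> [x xt i _ j _ ij _|x xt i j ij]; first exact: xt.
exact: xt.
Qed.

Lemma compact_is_product (S : inverse_system) : compact [set: is_product S].
Proof.
have := @tychonoff (is_index S) (fun i => discrete_topology (is_obj i))
  (fun i => [set: is_obj i]).
rewrite (_ : mkset _ = setT); last by apply/seteqP; split.
apply=> i; apply: finite_compact; exact: (@finite_finset (is_obj i)).
Qed.

Lemma pro_class_residually (G : topGroupType) :
  pro_class C G -> residually_class C G.
Proof.
case=> S [CS [p [pM pI pR pO]]].
have hp i : finite_hom C (fun x => p x i).
  split=> [x y||]; [exact: pM| |exact: CS].
  by apply/pO; exists [set x : is_product S | x i = 1] => //; exact: (@open_coordinate S i [set 1]).
have cG : compact [set: G].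
  (* As [p] induces the topology of [G], a cluster point of the image filter among the threads,
     which form a compact set, comes from a cluster point in [G]. *)
  move=> F FF FT.
  have ct : compact (threads (S := S)).
    exact: (subclosed_compact (@closed_threads S) (@compact_is_product S)).
  have pF : F (p @^-1` threads (S := S)).
    by apply: filterS FT => g _; rewrite -pR; exists g.
  have [x [xt clx]] := ct (p @ F) _ pF.
  move: xt clx; rewrite -pR => -[g _ <-{x}] clx; exists g; split=> // A B FA.
  rewrite nbhsE => -[U [/pO[W oW ->] Wg] UB].
  have pA : F (p @^-1` (p @` A)) by apply: filterS FA => y Ay; exists y.
  have [|x [[y Ay <-] Wx]] := clx (p @` A) W pA.
    by rewrite nbhsE; exists W.
  by exists y; split=> //; exact: UB.
apply: (residually_class_sep hC cG).
  by have [i _] := is_inhabited S; exists (is_obj i), (fun x => p x i).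
move=> x x1; apply: contrapT => nx; apply: x1; apply: pI.
apply: functional_extensionality_dep => i; rewrite [RHS](hom1 (pM i)).
by apply: contrapT => xi; apply: nx; exists (is_obj i), (fun x => p x i).
Qed.

Section Limit.
Variable G : topGroupType.
Hypothesis hG : residually_class C G.

Let ker_of (U : set G) : Prop := exists (H : finGroupType) (f : G -> H),
  [/\ finite_hom C f, forall y, exists x, f x = y & forall x, f x = 1 <-> U x].

(** Indices are kernels and not homomorphisms: two kernels that contain each other are equal, as
    [is_anti] requires, and the index type stays in a small universe. [classic] supplies the
    equality. *)
Let index := {classic {U : set G | ker_of U}}.
Let le (i j : index) : Prop := projT1 j `<=` projT1 i.
Let obj (i : index) : finGroupType := projT1 (cid (projT2 i)).
Let pr (i : index) : G -> obj i := projT1 (cid (projT2 (cid (projT2 i)))).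

Let prP (i : index) : [/\ finite_hom C (@pr i), forall y, exists x, pr i x = y
  & forall x, pr i x = 1 <-> projT1 i x].
Proof. exact: (projT2 (cid (projT2 (cid (projT2 i))))). Qed.

Let prM i : {morph pr i : x y / x * y}. Proof. by case: (prP i) => -[]. Qed.

Let sec (i : index) (y : obj i) : G :=
  projT1 (cid (let: And3 _ s _ := prP i in s y)).

Let secK i y : pr i (@sec i y) = y.
Proof. exact: (projT2 (cid (let: And3 _ s _ := prP i in s y))). Qed.

Let map (i j : index) (_ : le i j) (y : obj j) : obj i := pr i (@sec j y).

Let mapE i j (ij : le i j) x : map ij (pr j x) = pr i x.
Proof.
apply/(hom_eq (@prM i)); have [_ _ kj] := prP j; have [_ _ ki] := prP i.
apply/ki/ij/kj; rewrite prM (homV (@prM j)) secK.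
exact: mulVg.
Qed.

Let ker_index (H : finGroupType) (f : G -> H) : finite_hom C f ->
  exists i : index, forall x, pr i x = 1 <-> f x = 1.
Proof.
move=> hf; have [K [g [hg gs gf]]] := finite_hom_surj hC hf.
have kg : ker_of [set x | f x = 1] by exists K, g; split=> //.
exists (exist _ _ kg : index) => x.
by have [_ _] := prP (exist _ _ kg : index); apply.
Qed.

Let le_directed (i j : index) : exists k, le i k /\ le j k.
Proof.
have [hi _ ki] := prP i; have [hj _ kj] := prP j.
have [k kE] := ker_index (finite_hom_pair hC hi hj); exists k.
by have [_ _ kk] := prP k; split=> x /kk /kE [? ?]; [apply/ki|apply/kj].
Qed.

Let index_inhabited : exists i : index, True.
Proof.
have [_ _ /(_ setT openT)[//|H [f [hf _]]]] := hG.
by have [i _] := ker_index hf; exists i.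
Qed.

Lemma residually_pro_class : pro_class C G.
Proof.
have anti : forall i j : index, le i j -> le j i -> i = j.
  move=> [U kU] [V kV] VU UV; have e : U = V by apply/seteqP; split.
  by case: _ / e kV {VU UV} => kV; congr exist; exact: Prop_irrelevance.
pose S := @InverseSystem index le (fun _ _ => id) anti
  (fun i j k ij jk x kx => ij x (jk x kx)) index_inhabited le_directed obj map.
have mM : forall i j (ij : le i j), {morph map ij : x y / x * y}.
  move=> i j ij x y; rewrite -{1}(secK x) -{1}(secK y) -prM mapE.
  exact: prM.
have mid : forall i (ii : le i i) x, map ii x = x by move=> i ii x; exact: secK.
have mcomp : forall i j k (ij : le i j) (jk : le j k) (ik : le i k) x,
    map ij (map jk x) = map ik x.
  by move=> i j k ij jk ik x; rewrite -(secK x) !mapE.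
exists (S mM mid mcomp); split.
  by move=> i; have [[]] := prP i.
have [cG _ bG] := hG.
exists (fun x i => pr i x); split.
- by move=> i x y; exact: prM.
- move=> x y exy; apply: contrapT => nxy.
  have [_ c1 _] := hG.
  have [||H [f [hf fW]]] := bG (~` [set x^-1 * y]).
  + rewrite -closedC setCK (_ : [set _] = (fun z => z * (x^-1 * y)^-1) @^-1` [set 1]).
      exact: closed_preimage (continuous_rmul _) c1.
    apply/seteqP; split=> z /=; first by move=> ->; rewrite mulgV.
    by move=> e; rewrite -[z](mulgVK (x^-1 * y)) e mul1g.
  + by move=> /= e; apply: nxy; rewrite -[y](mulKVg x) -e mulg1.
  have [i ki] := ker_index hf.
  have /ki /fW /= := iffLR (hom_eq (@prM i) x y) (congr1 (fun f => f i) exy).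
  exact.
- apply/seteqP; split=> [_ [x _ <-] i j ij|x xt]; first exact: mapE.
  have [||||g _ gx] := @compact_directed _ _ index (fun i => [set g | pr i g = x i]) cG.
  + by have [i _] := index_inhabited; exact: inhabits.
  + move=> i; have [hi _ _] := prP i; exact: (@finite_hom_closed _ _ _ _ [set x i] hi).
  + move=> i j; have [k [ik jk]] := le_directed i j; exists k => g /= gk.
    by rewrite -(xt i k ik) -(xt j k jk) -gk /= !mapE.
  + move=> i; have [_ /(_ (x i))[g gi] _] := prP i; by exists g.
  by exists g => //; apply: functional_extensionality_dep => i; exact: gx.
- move=> U; split=> [oU|[W oW ->]].
    exists (\bigcup_(ih in [set ih : {i : index & obj i} |
       (forall g, pr (projT1 ih) g = projT2 ih -> U g)])
       [set x : is_product (S mM mid mcomp) | x (projT1 ih) = projT2 ih]).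
      apply: bigcup_open => -[i h] _.
      exact: (@open_coordinate (S mM mid mcomp) i [set h]).
    apply/seteqP; split=> [g Ug|g [[i h] /= iU] /= gi]; last exact: iU.
    have [||H [f [hf fW]]] := bG ((fun x => g * x) @^-1` U).
    + exact: open_preimage (continuous_lmul g) oU.
    + by rewrite /= mulg1.
    have [i ki] := ker_index hf; exists (existT _ i (pr i g)) => //= x.
    move/esym/(hom_eq (@prM i))/ki/fW; by rewrite /= mulKVg.
  apply: open_preimage oW; apply: continuous_prod => i.
  apply/continuousP => A _; have [hi _ _] := prP i.
  exact: (@finite_hom_open _ _ _ _ A hi).
Qed.

End Limit.

End ProClass.

(** * Separation in profinite groups *)

Definition normal_subgroup (G : groupType) (N : set G) : Prop :=
  [/\ N 1, forall x y, N x -> N y -> N (x * y), forall x, N x -> N x^-1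
    & forall g x, N x -> N (g * x * g^-1)].

Lemma cns_normal (G : topGroupType) (N : closed_normal_subgroup G) :
  normal_subgroup N.
Proof. by split; [exact: cns1|exact: cnsM|exact: cnsV|exact: cnsJ]. Qed.

Section Residual.
Variables (C : finite_group_class) (hC : closed_class C).
Variables (G : topGroupType) (hG : residually_class C G).

(** If every homomorphism to a finite group of the class identified a point of [A] with a point of
    [K], compactness of the product would give one pair whose quotient lies in all kernels, so that
    the two points coincide. *)
Lemma separate_sets (A K : set G) : closed A -> closed K -> A `&` K = set0 ->
  exists (H : finGroupType) (f : G -> H),
    finite_hom C f /\ forall a k, A a -> K k -> f a <> f k.
Proof.
move=> cA cK AK; have [cG c1 bG] := hG.
(* The family is indexed by kernels: the type of all homomorphisms to finite
   groups lives in too large a universe. *)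
pose ker_of (U : set G) := exists (H : finGroupType) (f : G -> H),
  finite_hom C f /\ forall x, U x <-> f x = 1.
pose F (U : {U : set G | ker_of U}) : set (G * G) :=
  [set p | projT1 U (p.1^-1 * p.2)].
apply: contrapT => nf.
have [[a k] [/= Aa Kk] ak] : exists2 p, (A `*` K) p & forall i, F i p.
  apply: (@compact_directed _ (A `*` K) _ F).
  - by apply: compact_setX; apply: (subclosed_compact _ cG).
  - have [||H [f [hf _]]] := bG setT; [exact: openT|by []|].
    have kf : ker_of [set x | f x = 1] by exists H, f.
    exact: (inhabits (exist _ _ kf)).
  - move=> [U [H [f [hf fU]]]]; rewrite /F /=.
    rewrite (_ : mkset _ = (fun p : G * G => p.1^-1 * p.2) @^-1` (f @^-1` [set 1])).
      apply: (@closed_preimage _ _ (fun p : G * G => p.1^-1 * p.2)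
        (f @^-1` [set 1])); last exact: (@finite_hom_closed _ _ _ _ [set 1] hf).
      apply: continuous_mul; last by move=> x; exact: cvg_snd.
      by apply: continuous_inv => x; exact: cvg_fst.
    by apply/seteqP; split=> p /= /fU.
  - move=> [U [H [f [hf fU]]]] [U' [H' [f' [hf' fU']]]].
    have kUU : ker_of (U `&` U').
      exists (H * H')%type, (fun x => (f x, f' x)); split.
        exact: finite_hom_pair.
      by move=> x; split=> [[/fU -> /fU' ->]|[/fU ? /fU' ?]].
    by exists (exist _ _ kUU) => p [].
  - move=> [U [H [f [hf fU]]]]; apply: contrapT => n0; apply: nf; exists H, f; split=> //.
    move=> a k Aa Kk fak; apply: n0; exists (a, k); split=> //; apply/fU.
    by apply/hom_eq => //; case: hf.
have nak : a^-1 * k <> 1.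
  move=> e; have : (A `&` K) a; last by rewrite AK.
  by split=> //; rewrite (_ : a = k) // -[k](mulKVg a) e mulg1.
have [||H [f [hf fW]]] := bG (~` [set a^-1 * k]).
- rewrite -closedC setCK (_ : [set _] = (fun z => z * (a^-1 * k)^-1) @^-1` [set 1]).
    exact: closed_preimage (continuous_rmul _) c1.
  apply/seteqP; split=> z /=; first by move=> ->; rewrite mulgV.
  by move=> e; rewrite -[z](mulgVK (a^-1 * k)) e mul1g.
- by move=> /= /esym.
have kf : ker_of [set x | f x = 1] by exists H, f.
by have /fW := ak (exist _ _ kf); apply.
Qed.

Lemma closed_point (x : G) : closed [set x].
Proof.
have [_ c1 _] := hG.
rewrite (_ : [set x] = (fun z => z * x^-1) @^-1` [set 1]).
  exact: closed_preimage (continuous_rmul _) c1.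
apply/seteqP; split=> z /=; first by move=> ->; rewrite mulgV.
by move=> e; rewrite -[z](mulgVK x) e mul1g.
Qed.

Lemma separate_points (x y : G) : x <> y ->
  exists (H : finGroupType) (f : G -> H), finite_hom C f /\ f x <> f y.
Proof.
move=> xy; have [|||H [f [hf fxy]]] := @separate_sets [set x] [set y].
- exact: closed_point.
- exact: closed_point.
- by apply/seteqP; split=> // z [-> ] /= /xy.
by exists H, f; split=> //; exact: fxy.
Qed.

Lemma residually_hausdorff : hausdorff_space G.
Proof.
move=> x y clxy; apply: contrapT => /separate_points[H [f [hf fxy]]].
have nf (z : G) : nbhs z (f @^-1` [set f z]).
  rewrite nbhsE; exists (f @^-1` [set f z]) => //.
  by split=> //; exact: (@finite_hom_open _ _ _ _ [set f z] hf).
by have [z [/= ex ey]] := clxy _ _ (nf x) (nf y); apply: fxy; rewrite -ex ey.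
Qed.

Lemma closed_image (X : topologicalType) (f : X -> G) (A : set X) :
  continuous f -> compact A -> closed (f @` A).
Proof.
move=> cf cA; apply: compact_closed; first exact: residually_hausdorff.
apply: continuous_compact => //; exact: continuous_subspaceT.
Qed.

(** The new target is the image of [f] modulo the image of [L]. Since [L] contains the kernel of
    [f], membership in [L] can be read off from the image. *)
Lemma finite_hom_coarsen (H : finGroupType) (f : G -> H) (L : set G) :
  finite_hom C f -> normal_subgroup L -> (forall x, f x = 1 -> L x) ->
  exists (K : finGroupType) (g : G -> K),
    [/\ finite_hom C g, forall y, exists x, g x = y
      & forall x, g x = 1 <-> L x].
Proof.
move=> hf [L1 LM LV LJ] fL; have [H1 [g [hg gs gf]]] := finite_hom_surj hC hf.
have [gM go gC] := hg.
pose A0 := [set y : H1 | `[<exists2 x, L x & g x = y>]]%SET.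
have gA : group_set A0.
  apply/group_setP; split.
    by rewrite finset.inE; apply/asboolP; exists 1 => //; exact: (hom1 gM).
  move=> a b; rewrite !finset.inE => /asboolP[x Lx <-] /asboolP[y Ly <-].
  by apply/asboolP; exists (x * y); [exact: LM|exact: gM].
pose A := Group gA.
have AP x : (g x \in A) <-> L x.
  rewrite finset.inE; split=> [/asboolP[z Lz]|Lx]; last first.
    by apply/asboolP; exists x.
  move=> /(hom_eq gM) /gf /fL /(LM _ _ Lz).
  by rewrite mulKVg.
have nA : A <| [set: H1]%SET.
  rewrite /normal finset.subsetT; apply/fintype.subsetP => y _; rewrite finset.inE.
  apply/fintype.subsetP => _ /imsetP[a aA ->].
  have [u <-] := gs y; have [v gv] := gs a; rewrite -gv in aA *.
  rewrite conjgE -(homV gM) -!gM; apply/AP.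
  by have := LJ u^-1 v (iffLR (AP v) aA); rewrite invgK -mulgA.
have inN x : x \in 'N(A) by have /andP[_ /fintype.subsetP] := nA; apply.
exists (coset_of A), (fun x => coset A (g x)).
have kerP x : coset A (g x) = 1 <-> L x.
  split=> [e|/AP gA']; last exact: coset_id.
  by apply/AP; apply: coset_idr e; exact: inN.
split=> //.
- split.
  + by move=> x y; rewrite gM morphM.
  + rewrite (_ : _ @^-1` _ = g @^-1` [set y | coset A y = 1]) //.
    exact: (finite_hom_open _ hg).
  + have := class_quo hC nA gC.
    suff -> : ([set: H1] / A)%G = [set: coset_of A]%G by [].
    apply/val_inj/setP => y; rewrite finset.in_setT.
    by have [x Nx ->] := cosetP y; exact: mem_quotient.
- by move=> y; have [z _ ->] := cosetP y; have [x <-] := gs z; exists x.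
Qed.

Lemma open_normal_quotient (L : set G) : open L -> normal_subgroup L ->
  exists (K : finGroupType) (g : G -> K),
    [/\ finite_hom C g, forall y, exists x, g x = y
      & forall x, g x = 1 <-> L x].
Proof.
move=> oL nL; have [_ _ /(_ L oL)[]] := hG; first by case: nL.
by move=> H [f [hf fL]]; exact: (finite_hom_coarsen hf nL fL).
Qed.

End Residual.

(** * Quotients *)

Lemma quotient_residually (C : finite_group_class) (P Q : topGroupType)
    (K : set P) (q : P -> Q) :
  closed_class C -> residually_class C P -> closed K -> is_quotient_map K q ->
  residually_class C Q.
Proof.
move=> hC hP cK [[qM qc] qs qK qo].
have nK : normal_subgroup K.
  split.
  - by apply/qK; exact: hom1.
  - by move=> x y /qK ex /qK ey; apply/qK; rewrite qM ex ey mul1g.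
  - by move=> x /qK ex; apply/qK; rewrite (homV qM) ex invg1.
  - by move=> g x /qK ex; apply/qK; rewrite !qM (homV qM) ex mulg1 mulgV.
have [K1 KM KV KJ] := nK.
(* Dividing the image of [f] by the image of [K] makes [f] factor through [q]; the kernel upstairs
   becomes the product of [K] and the kernel of [f]. *)
have descend (H : finGroupType) (f : P -> H) : finite_hom C f ->
    exists (H' : finGroupType) (f' : Q -> H'), finite_hom C f' /\
      forall x, f' (q x) = 1 <-> exists2 k, K k & f x = f k.
  move=> hf; have [fM _ _] := hf.
  pose L := [set x | exists2 k, K k & f x = f k].
  have nL : normal_subgroup L.
    split.
    - by exists 1.
    - by move=> x y [k Kk ek] [l Kl el]; exists (k * l); [exact: KM|rewrite !fM ek el].
    - by move=> x [k Kk ek]; exists k^-1; [exact: KV|rewrite !(homV fM) ek].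
    - by move=> g x [k Kk ek]; exists (g * k * g^-1); [exact: KJ|rewrite !fM ek].
  have [|H' [g [hg _ gL]]] := finite_hom_coarsen hC hf nL.
    by move=> x fx; exists 1 => //; rewrite fx (hom1 fM).
  have [gM _ gC] := hg.
  pose f' y := g (projT1 (cid (qs y))).
  have f'E x : f' (q x) = g x.
    rewrite /f'; case: cid => z /= /(hom_eq qM)/qK Kz; apply/(hom_eq gM)/gL.
    by exists (z^-1 * x).
  exists H', f'; split; last by move=> x; rewrite f'E; exact: gL.
  split=> //.
    move=> y y'; have [x <-] := qs y; have [x' <-] := qs y'.
    by rewrite -qM !f'E gM.
  apply: qo; rewrite (_ : _ @^-1` _ = g @^-1` [set 1]).
    exact: (finite_hom_open _ hg).
  by apply/seteqP; split=> x; rewrite /= f'E.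
have [cP _ bP] := hP.
apply: (residually_class_sep hC).
- rewrite (_ : [set: Q] = q @` [set: P]).
    by apply: continuous_compact => //; exact: continuous_subspaceT.
  by apply/seteqP; split=> // y _; have [x <-] := qs y; exists x.
- have [||H [f [hf _]]] := bP setT; [exact: openT|by []|].
  by have [H' [f' [hf' _]]] := descend H f hf; exists H', f'.
- move=> y y1; have [x ex] := qs y.
  have nKx : ~ K x by move=> /qK e; apply: y1; rewrite -ex.
  have [|||H [f [hf fx]]] := @separate_sets C hC P hP [set x] K.
  + exact: (closed_point hP).
  + exact: cK.
  + by apply/seteqP; split=> // z [-> ].
  have [H' [f' [hf' f'P]]] := descend H f hf; exists H', f'; split=> //.
  by rewrite -ex => /f'P[k Kk]; exact: fx.
Qed.

Section QuotientGroup.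
Variables (G : topGroupType) (K : closed_normal_subgroup G).

Definition coset_rel (x y : G) : bool := `[< cns_set K (x^-1 * y) >].

Lemma coset_rel_equiv : equiv_class_of coset_rel.
Proof.
split.
- by move=> x; apply/asboolP; rewrite mulVg; exact: cns1.
- move=> x y; apply/asboolP/asboolP => /cnsV; by rewrite invgM invgK.
- move=> y x z /asboolP xy /asboolP yz; apply/asboolP.
  by have := cnsM xy yz; rewrite -mulgA mulVKg.
Qed.

Canonical coset_equiv := EquivRelPack coset_rel_equiv.

Definition coset_space := quotient_topology {eq_quot coset_equiv}%qT.

HB.instance Definition _ := Topological.on coset_space.

Definition coset_pi (x : G) : coset_space := \pi_({eq_quot coset_equiv})%qT x.

Lemma coset_piP x y : coset_pi x = coset_pi y <-> cns_set K (x^-1 * y).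
Proof. by split=> [/eqmodP /asboolP|h]; last by apply/eqmodP/asboolP. Qed.

Definition coset_repr (a : coset_space) : G := generic_quotient.repr (a : {eq_quot coset_equiv}%qT).

Lemma coset_reprK a : coset_pi (coset_repr a) = a.
Proof. exact: reprK. Qed.

Definition coset_mul (a b : coset_space) : coset_space :=
  coset_pi (coset_repr a * coset_repr b).
Definition coset_inv (a : coset_space) : coset_space := coset_pi (coset_repr a)^-1.

Lemma coset_piM x y : coset_mul (coset_pi x) (coset_pi y) = coset_pi (x * y).
Proof.
apply/coset_piP; rewrite invgM.
set x' := coset_repr (coset_pi x); set y' := coset_repr (coset_pi y).
have /coset_piP Kx : coset_pi x' = coset_pi x by exact: coset_reprK.
have /coset_piP Ky : coset_pi y' = coset_pi y by exact: coset_reprK.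
have := cnsM (cnsJ y'^-1 Kx) Ky; rewrite invgK.
by rewrite !mulgA mulgK.
Qed.

Lemma coset_piV x : coset_inv (coset_pi x) = coset_pi x^-1.
Proof.
apply/coset_piP; rewrite invgK; set x' := coset_repr _.
have /coset_piP Kx : coset_pi x = coset_pi x' by rewrite coset_reprK.
have := cnsJ x Kx; by rewrite mulVKg.
Qed.

Lemma coset_mulA : associative coset_mul.
Proof.
move=> a b c; rewrite -(coset_reprK a) -(coset_reprK b) -(coset_reprK c).
by rewrite !coset_piM mulgA.
Qed.

Lemma coset_mul1g : left_id (coset_pi 1) coset_mul.
Proof. by move=> a; rewrite -(coset_reprK a) coset_piM mul1g. Qed.

Lemma coset_mulg1 : right_id (coset_pi 1) coset_mul.
Proof. by move=> a; rewrite -(coset_reprK a) coset_piM mulg1. Qed.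

Lemma coset_mulVg : left_inverse (coset_pi 1) coset_inv coset_mul.
Proof. by move=> a; rewrite -(coset_reprK a) coset_piV coset_piM mulVg. Qed.

Lemma coset_mulgV : right_inverse (coset_pi 1) coset_inv coset_mul.
Proof. by move=> a; rewrite -(coset_reprK a) coset_piV coset_piM mulgV. Qed.

HB.instance Definition _ := monoid.isGroup.Build coset_space
  coset_mulA coset_mul1g coset_mulg1 coset_mulVg coset_mulgV.

Lemma coset_pi_continuous : continuous coset_pi.
Proof. exact: pi_continuous. Qed.

Lemma coset_pi_open (U : set coset_space) : open (coset_pi @^-1` U) -> open U.
Proof. by []. Qed.

(** The saturation of an open set is a union of translates. Openness of the projection is the key to
    continuity of the multiplication, because a product of two quotient maps need not be a quotient
    map. *)
Lemma coset_pi_image_open (U : set G) : open U -> open (coset_pi @` U).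
Proof.
move=> oU; apply: coset_pi_open.
rewrite (_ : _ @^-1` _ = \bigcup_(k in K) ((fun x => x * k) @^-1` U)).
  by apply: bigcup_open => k _; exact: open_preimage (continuous_rmul k) oU.
apply/seteqP; split=> [x [y Uy /esym /coset_piP Kxy]|x [k Kk /= Uxk]].
  by exists (x^-1 * y) => //=; rewrite mulVKg.
by exists (x * k) => //; apply/esym/coset_piP; rewrite mulKg.
Qed.

Lemma coset_pi_nbhs x (U : set G) : nbhs x U -> nbhs (coset_pi x) (coset_pi @` U).
Proof.
rewrite nbhsE => -[V [oV Vx] VU]; rewrite nbhsE; exists (coset_pi @` V).
  by split; [exact: coset_pi_image_open|exists x].
exact: image_subset.
Qed.

Lemma coset_mul_continuous :
  continuous (fun xy : coset_space * coset_space => xy.1 * xy.2).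
Proof.
move=> [a b]; rewrite -(coset_reprK a) -(coset_reprK b) => W /=.
set x := coset_repr a; set y := coset_repr b.
rewrite [_ * _](coset_piM x y) => /coset_pi_continuous nW.
have [[U V] [/= nU nV] UV] := @mulg_continuous G (x, y) _ nW.
exists (coset_pi @` U, coset_pi @` V).
  by split; exact: coset_pi_nbhs.
move=> [_ _] [/= [u Uu <-] [v Vv <-]].
by rewrite /= [_ * _](coset_piM u v); exact: (UV (u, v)).
Qed.

Lemma coset_inv_continuous : continuous (fun a : coset_space => a^-1).
Proof.
move=> a; rewrite -(coset_reprK a) => W /=; set x := coset_repr a.
rewrite [_^-1](coset_piV x) => /coset_pi_continuous nW.
have nV := @invg_continuous G x _ nW.
apply: filterS (coset_pi_nbhs nV) => _ [u Vu <-] /=.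
by rewrite [_^-1](coset_piV u).
Qed.

HB.instance Definition _ := isTopologicalGroup.Build coset_space
  coset_mul_continuous coset_inv_continuous.

Lemma quotient_exists : exists (Q : topGroupType) (q : G -> Q), is_quotient_map K q.
Proof.
exists coset_space, coset_pi; split.
- split; last exact: coset_pi_continuous.
  by move=> x y; rewrite -coset_piM.
- by move=> a; exists (coset_repr a); exact: coset_reprK.
- by move=> x; rewrite -[1]/(coset_pi 1) coset_piP mulg1; split=> /cnsV //; rewrite invgK.
- exact: coset_pi_open.
Qed.

End QuotientGroup.

(** * Trees and circuits *)

Lemma uniq_map_inj (A B : eqType) (f : A -> B) (s : seq A) (x y : A) :
  uniq (map f s) -> x \in s -> y \in s -> f x = f y -> x = y.
Proof.
elim: s => //= a s IH /andP[fa us]; rewrite !inE => /predU1P[->|xs] /predU1P[->|ys] //.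
- by move=> e; rewrite e map_f in fa.
- by move=> e; rewrite -e map_f in fa.
- exact: IH.
Qed.

Section Graphs.
Variable X : finite_graph.

(** The relation [adjacent] for a bare set of edges, so that an edge can be removed or added without
    keeping track of a set of vertices. *)
Definition edge_rel (E : {set edge X}) : rel (vert X) :=
  fun x y => [exists e in E, exists i,
                (endpoint i e == x) && (endpoint (~~ i) e == y)].

Lemma edge_relP (E : {set edge X}) x y :
  edge_rel E x y -> exists a : edge X * bool,
    [/\ a.1 \in E, origin a = x & terminus a = y].
Proof.
case/existsP => e /andP[eE /existsP[i /andP[/eqP ex /eqP ey]]].
by exists (e, i).
Qed.

Lemma edge_rel_arrow (E : {set edge X}) (a : edge X * bool) :
  a.1 \in E -> edge_rel E (origin a) (terminus a).
Proof.
move=> aE; apply/existsP; exists a.1; rewrite aE; apply/existsP; exists a.2.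
by rewrite /origin /terminus !eqxx.
Qed.

Lemma edge_rel_sym (E : {set edge X}) : symmetric (edge_rel E).
Proof.
suff h x y : edge_rel E x y -> edge_rel E y x by move=> x y; apply/idP/idP; exact: h.
case/edge_relP => -[e i] [/= eE <- <-].
by have := edge_rel_arrow (a := (e, ~~ i)) eE; rewrite /origin /terminus /= negbK.
Qed.

(** The edge of the first arrow cannot recur: both its ends would then lie in [y :: p], whereas one
    of them is [x]. The arrow [a0] only provides a terminus for the first arrow to start from. *)
Lemma path_arrows (E : {set edge X}) x p (a0 : edge X * bool) :
  path (edge_rel E) x p -> uniq (x :: p) -> terminus a0 = x ->
  exists c : seq (edge X * bool),
    [/\ all (fun a => a.1 \in E) c, map (@origin X) c = belast x p,
      map (@terminus X) c = p, uniq [seq a.1 | a <- c]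
      & path (fun a b => terminus a == origin b) a0 c].
Proof.
elim: p x a0 => [|y p IH] x a0; first by exists [::].
move=> /= /andP[/edge_relP[a [aE ax ay]] yp] /andP[xyp uyp] a0x.
have [c [cE co ct uc pc]] := IH y a yp uyp ay.
exists (a :: c); split; rewrite /= ?aE ?co ?ct ?ax ?ay ?a0x ?eqxx //.
rewrite uc andbT; apply: contra xyp => /mapP[b bc ab].
have ob : origin b \in y :: p.
  by apply: mem_belast; rewrite -co; exact: map_f.
have tb : terminus b \in y :: p.
  by rewrite inE -ct [X in _ || X]map_f ?orbT.
move: ob tb; rewrite -ax /origin /terminus -ab.
by case: (a.2); case: (b.2).
Qed.

Lemma connected_circuit (E : {set edge X}) (a : edge X * bool) :
  a.1 \notin E -> connect (edge_rel E) (terminus a) (origin a) ->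
  exists2 c, circuit c & all (fun b => b.1 \in a.1 |: E)%SET c.
Proof.
move=> aE /connectP[p0 p0p p0l]; case/shortenP: p0p p0l => p pp up _ pl.
have [c [cE co ct uc pc]] := path_arrows pp up (erefl (terminus a)).
exists (a :: c); last first.
  rewrite /= finset.setU11; apply: sub_all cE => b bE.
  by rewrite finset.inE bE orbT.
rewrite /circuit /= rcons_path pc /= uc co.
have -> : terminus (last a c) = origin a.
  by rewrite -(last_map (@terminus X)) ct -pl.
rewrite eqxx /= andbT.
have ue : a.1 \notin [seq b.1 | b <- c].
  apply/mapP => -[b bc e]; move: aE; rewrite e.
  by have /allP/(_ b bc) -> := cE.
rewrite ue /=.
by have := up; rewrite lastI -pl rcons_uniq.
Qed.

Definition acyclic (E : {set edge X}) : Prop :=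
  forall c : seq (edge X * bool), circuit c -> ~~ all (fun a => a.1 \in E) c.

(* On a forest every cochain with values in a group is a coboundary. *)
Lemma forest_potential (A : groupType) (S : set A) (E : {set edge X})
    (l : edge X -> A) :
  S 1 -> (forall x y, S x -> S y -> S (x * y)) -> (forall x, S x -> S x^-1) ->
  acyclic E -> (forall e, e \in E -> S (l e)) ->
  exists z : vert X -> A, (forall v, S (z v)) /\
    forall e, e \in E -> z (endpoint false e) * l e * (z (endpoint true e))^-1 = 1.
Proof.
move=> S1 SM SV; have [n] := ubnP #|E|; elim: n E => // n IH E Ecard acE lS.
have [->|[e eE]] := set_0Vmem E.
  by exists (fun=> 1); split=> // e; rewrite finset.inE.
have EE : (E :\ e \subset E)%SET by exact: subD1set.
have [||f fE|z [zS zl]] := IH (E :\ e)%SET.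
- by move: Ecard; rewrite (cardsD1 e) eE.
- move=> c /acE; apply: contra; apply: sub_all => a.
  exact: (fintype.subsetP EE).
- by apply: lS; exact: (fintype.subsetP EE).
pose u := endpoint false e; pose w := endpoint true e.
have nuw : ~~ connect (edge_rel (E :\ e)%SET) w u.
  apply/negP => cuw; have [||c cc cE] := @connected_circuit (E :\ e)%SET (e, false).
  - by rewrite !finset.inE eqxx.
  - exact: cuw.
  have /negP := acE _ cc; apply; apply: sub_all cE => a.
  by rewrite /= finset.setD1K.
(* [s] is the defect of [z] at the removed edge [e]. Multiplying [z] by [s] on the component of [w]
   repairs [e], since [u] lies outside it, and keeps the other relations, since the two ends of
   another edge share a component. *)
pose s := z u * l e * (z w)^-1.
pose z' x := if connect (edge_rel (E :\ e)%SET) w x then s * z x else z x.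
have sS : S s by apply: (SM); [apply: (SM) => //; exact: lS|exact: SV].
exists z'; split=> [x|f fE]; first by rewrite /z'; case: ifP => // _; exact: SM.
have [->|fe] := eqVneq f e.
  by rewrite /z' (negbTE nuw) connect0 invgM /s !mulgA -/u -/w mulgKA mulgV.
have fEe : f \in (E :\ e)%SET by rewrite !finset.inE fe.
have cf : connect (edge_rel (E :\ e)%SET) w (endpoint false f) =
          connect (edge_rel (E :\ e)%SET) w (endpoint true f).
  apply: same_connect_r; first exact: sym_connect_sym (edge_rel_sym _).
  exact: connect1 (edge_rel_arrow (a := (f, false)) fEe).
have := zl f fEe; rewrite /z' cf; case: ifP => // _ zf.
by rewrite invgM !mulgA -(mulgA s) -(mulgA s) zf mulg1 mulgV.
Qed.

(** Were a vertex missing, connectedness would give an edge that leaves [T]; adding it together with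
    its far end yields a larger subtree. *)
Lemma maximal_subtree_spanning (T : subgraph X) :
  graph_connected X -> maximal_subtree T -> forall v, v \in sub_vert T.
Proof.
move=> [_ cX] [[[T0 cT] acT] maxT] v; apply: contraT => vT.
have [r rT] := set0Pn _ T0.
have [a [oT tT]] : exists a : edge X * bool,
    origin a \in sub_vert T /\ terminus a \notin sub_vert T.
  have /connectP[p pp pl] := cX r v (finset.in_setT _) (finset.in_setT _).
  elim: p r rT pp pl => [|x p IH] r rT /=; first by move=> _ e; rewrite e rT in vT.
  case/andP => /edge_relP[a [_ ar ax]] pp pl.
  have [xT|xT] := boolP (x \in sub_vert T); first exact: (IH x).
  by exists a; rewrite ar ax.
pose SV := (terminus a |: sub_vert T)%SET; pose SE := (a.1 |: sub_edge T)%SET.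
have closS i e : e \in SE -> endpoint i e \in SV.
  rewrite !finset.inE => /orP[/eqP->|/(sub_closed i) ->]; last by rewrite orbT.
  move: oT; rewrite /origin /terminus; case: a.2 i => -[] /=; rewrite ?eqxx // => ->;
  by rewrite orbT.
pose S := Subgraph closS.
have sTE : (sub_edge T \subset SE) by exact: finset.subsetUr.
have mono x y : connect (adjacent T) x y -> connect (adjacent S) x y.
  apply: connect_sub => {}x {}y /edge_relP[b [bT <- <-]]; apply: connect1.
  by apply: edge_rel_arrow; exact: (fintype.subsetP sTE).
have csym : connect_sym (adjacent S) by exact: sym_connect_sym (edge_rel_sym _).
have rS x : x \in SV -> connect (adjacent S) (origin a) x.
  rewrite finset.inE finset.in_set1 => /orP[/eqP ->|xT]; last by apply: mono; exact: cT.
  by apply: connect1; apply: edge_rel_arrow; exact: finset.setU11.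
have stS : subtree S.
  split.
    split; first by apply/set0Pn; exists (terminus a); exact: finset.setU11.
    move=> x y xS yS; apply: connect_trans (rS y yS).
    by rewrite csym; exact: rS.
  move=> c cc; apply/negP => cS.
  have cyc : path.cycle (fun a b => terminus a == origin b) c by case/and4P: cc.
  have ue : uniq [seq b.1 | b <- c] by case/and4P: cc.
  have [/mapP[b bc ab]|nac] := boolP (a.1 \in [seq b.1 | b <- c]); last first.
    have /negP := acT c cc; apply; apply/allP => b bc; have /allP/(_ b bc) := cS.
    rewrite finset.inE finset.in_set1 => /orP[/eqP ba|//]; case/negP: nac.
    by rewrite -ba; exact: map_f.
  (* Only the new edge touches the new vertex. A circuit through it would have to enter and leave
     that vertex along the same arrow [b], which would make [b] a loop. *)
  have eqb d : d \in c -> origin d = terminus a \/ terminus d = terminus a -> d = b.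
    move=> dc dt.
    have : d.1 \in SE by have /allP := cS; exact.
    rewrite finset.inE finset.in_set1 => /orP[/eqP da|dT].
      by apply: (uniq_map_inj ue dc bc); rewrite da.
    have od : origin d \in sub_vert T := sub_closed d.2 dT.
    have td : terminus d \in sub_vert T := sub_closed (~~ d.2) dT.
    by exfalso; move: tT; case: dt => <-; rewrite ?od ?td.
  have la : origin a <> terminus a by move=> e; rewrite -e oT in tT.
  have nb : origin b <> terminus b.
    move: la; rewrite /origin /terminus ab; case: a.2; case: b.2 => //= la e;
    exact: la.
  have tb : origin b = terminus a \/ terminus b = terminus a.
    by rewrite /origin /terminus -ab; case: a.2; case: b.2; [right|left|left|right].
  case: tb => [ob|tb].
    have /eqP e := prev_cycle cyc bc; apply: nb.
    by rewrite -{2}(eqb (prev c b)) ?mem_prev //; right; rewrite e.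
  have /eqP e := next_cycle cyc bc; apply: nb.
  by rewrite -{1}(eqb (next c b)) ?mem_next //; left; rewrite -e.
have [||eV _] := maxT S stS.
- exact: finset.subsetUr.
- exact: finset.subsetUr.
by move: tT; rewrite -eV finset.setU11.
Qed.

End Graphs.

(** * Generation and universal property of the fundamental group *)

(** An alias carrying both the group law and the discrete topology, so that finite groups can serve
    as targets of the universal properties. *)
Definition discrete_group (H : finGroupType) : Type := discrete_topology H.

HB.instance Definition _ (H : finGroupType) :=
  Topological.copy (discrete_group H) (discrete_topology H).
HB.instance Definition _ (H : finGroupType) :=
  monoid.Group.copy (discrete_group H) H.

Section DiscreteGroup.
Variable H : finGroupType.

Lemma discrete_group_open (A : set (discrete_group H)) : open A.
Proof. exact: (@discrete_open (discrete_topology H)). Qed.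

Lemma discrete_group_nbhs (x : discrete_group H) : nbhs x [set x].
Proof. by rewrite nbhsE; exists [set x] => //; split=> //; exact: discrete_group_open. Qed.

Lemma discrete_group_mul_continuous :
  continuous (fun xy : discrete_group H * discrete_group H => xy.1 * xy.2).
Proof.
move=> [x y] W /= /nbhs_singleton Wxy.
exists ([set x], [set y]); first by split; exact: discrete_group_nbhs.
by move=> [_ _] [/= -> ->].
Qed.

Lemma discrete_group_inv_continuous : continuous (fun x : discrete_group H => x^-1).
Proof. by apply/continuousP => A _; exact: discrete_group_open. Qed.

HB.instance Definition _ := isTopologicalGroup.Build (discrete_group H)
  discrete_group_mul_continuous discrete_group_inv_continuous.

Lemma discrete_group_residually (C : finite_group_class) :
  closed_class C -> C H [set: H]%G -> residually_class C (discrete_group H).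
Proof.
move=> hC CH; have hid : finite_hom C (fun x : discrete_group H => x : H).
  by split=> //; exact: discrete_group_open.
apply: (residually_class_sep hC).
- by apply: finite_compact; exact: (@finite_finset H).
- by exists H, (fun x => x).
- by move=> x x1; exists H, (fun x => x).
Qed.

Lemma finite_hom_continuous (C : finite_group_class) (G : topGroupType)
    (f : G -> H) :
  finite_hom C f -> continuous_hom (f : G -> discrete_group H).
Proof.
move=> hf; split; first by case: hf.
by apply/continuousP => A _; exact: (finite_hom_open _ hf).
Qed.

End DiscreteGroup.

Definition closed_subgroup (G : topGroupType) (S : set G) : Prop :=
  [/\ S 1, forall x y, S x -> S y -> S (x * y), forall x, S x -> S x^-1
    & closed S].

Section Universal.
Variables (C : finite_group_class) (hC : closed_class C).

Lemma closed_subgroup_full (G : topGroupType) (S : set G) :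
  residually_class C G -> closed_subgroup S ->
  (forall (H : finGroupType) (f : G -> H) (B : {group H}), finite_hom C f ->
    (forall x, S x -> f x \in B) -> forall x, f x \in B) ->
  forall x, S x.
Proof.
move=> hG [S1 SM SV cS] hS x; apply: contrapT => nSx.
have [|||H [f [hf fx]]] := @separate_sets C hC G hG [set x] S.
- exact: (closed_point hG).
- exact: cS.
- by apply/seteqP; split=> // z [-> ].
have [fM _ _] := hf.
have gB : group_set [set y : H | `[<exists2 s, S s & f s = y>]]%SET.
  apply/group_setP; split.
    by rewrite finset.inE; apply/asboolP; exists 1 => //; exact: hom1.
  move=> a b; rewrite !finset.inE => /asboolP[s Ss <-] /asboolP[t St <-].
  by apply/asboolP; exists (s * t); [exact: SM|exact: fM].
have : f x \in Group gB.
  apply: (hS H f (Group gB) hf) => s Ss.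
  by rewrite finset.inE; apply/asboolP; exists s.
rewrite finset.inE => /asboolP[s Ss e]; exact: (fx x s erefl Ss).
Qed.

Lemma subg_residually (H : finGroupType) (B : {group H}) :
  C [set: H]%G -> residually_class C (discrete_group (subg_of B)).
Proof.
move=> CH; apply: discrete_group_residually => //.
apply: (class_isog hC (isog_subg B)).
by apply: (class_sub hC) CH; exact: finset.subsetT.
Qed.

Lemma sgval_continuous_hom (H : finGroupType) (B : {group H}) :
  continuous_hom (sgval : discrete_group (subg_of B) -> discrete_group H).
Proof. by split=> //; apply/continuousP => A _; exact: discrete_group_open. Qed.

Lemma continuous_hom_comp (G H K : topGroupType) (f : G -> H) (g : H -> K) :
  continuous_hom f -> continuous_hom g -> continuous_hom (g \o f).
Proof.
move=> [fM fc] [gM gc]; split; first by move=> x y /=; rewrite fM gM.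
by move=> x; apply: continuous_comp; [exact: fc|exact: gc].
Qed.

(** If [f] sends the basis into [B], the universal property applied to the finite group [B] gives a
    second extension of the same values. Uniqueness identifies it with [f], whose image therefore
    lies in [B]. *)
Lemma free_proC_generated (I : finType) (F : topGroupType) (t : I -> F) :
  free_proC C t ->
  forall S : set F, closed_subgroup S -> (forall i, S (t i)) -> forall x, S x.
Proof.
move=> [pF uF] S clS St; apply: closed_subgroup_full => //.
  exact: pro_class_residually.
move=> H f B hf fB x; have [_ _ CH] := hf.
have pB := residually_pro_class hC (subg_residually B CH).
have pH := residually_pro_class hC (discrete_group_residually hC CH).
pose h i : discrete_group (subg_of B) := Subg (fB _ (St i)).
have [g [[hg gt] _]] := uF _ pB h.
have [k [_ uk]] := uF _ pH (fun i => f (t i)).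
have e1 := uk _ (conj (finite_hom_continuous hf) (fun i => erefl)).
have e2 : k = sgval \o g.
  apply: uk; split; first exact: continuous_hom_comp hg (sgval_continuous_hom B).
  by move=> i; rewrite /= gt.
by rewrite -[f x]/((f : F -> discrete_group H) x) -e1 e2; exact: subgP.
Qed.

Lemma free_proC_product_generated (I : finType) (A : I -> topGroupType)
    (P : topGroupType) (inj : forall i, A i -> P) :
  free_proC_product C inj ->
  forall S : set P, closed_subgroup S -> (forall i a, S (inj i a)) ->
  forall x, S x.
Proof.
move=> [pP cinj uP] S clS St; apply: closed_subgroup_full => //.
  exact: pro_class_residually.
move=> H f B hf fB x; have [fM _ CH] := hf.
have pB := residually_pro_class hC (subg_residually B CH).
have pH := residually_pro_class hC (discrete_group_residually hC CH).
pose h i a : discrete_group (subg_of B) := Subg (fB _ (St i a)).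
have hh i : continuous_hom (h i).
  have [iM ic] := cinj i; split; first by move=> a b; apply/val_inj; rewrite /= iM fM.
  apply/continuousP => U _.
  rewrite (_ : _ @^-1` _ = (inj i) @^-1` (f @^-1` [set y | exists2 u, U u & sgval u = y])).
    by apply: open_preimage ic _; exact: (finite_hom_open _ hf).
  apply/seteqP; split=> [a Ua|a [u Uu e]]; first by exists (h i a).
  by rewrite /= (_ : h i a = u) //; apply/val_inj.
have [g [[hg gt] _]] := uP _ pB h hh.
have cf := finite_hom_continuous hf.
have [k [_ uk]] := uP _ pH (fun i => f \o inj i)
  (fun i => continuous_hom_comp (cinj i) cf).
have e1 := uk _ (conj cf (fun i a => erefl)).
have e2 : k = sgval \o g.
  apply: uk; split; first exact: continuous_hom_comp hg (sgval_continuous_hom B).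
  by move=> i a; rewrite /= gt.
by rewrite -[f x]/((f : P -> discrete_group H) x) -e1 e2; exact: subgP.
Qed.

End Universal.

Lemma hom_kernel_closed_normal (C : finite_group_class) (G H : topGroupType)
    (f : G -> H) :
  residually_class C H -> continuous_hom f ->
  exists N : closed_normal_subgroup G, cns_set N = [set x | f x = 1].
Proof.
move=> [_ c1 _] [fM fc].
have k1 : [set x | f x = 1] 1 by exact: hom1.
have kM x y : f x = 1 -> f y = 1 -> f (x * y) = 1.
  by move=> ex ey; rewrite fM ex ey mul1g.
have kV x : f x = 1 -> f x^-1 = 1 by move=> ex; rewrite (homV fM) ex invg1.
have kJ g x : f x = 1 -> f (g * x * g^-1) = 1.
  by move=> ex; rewrite !fM (homV fM) ex mulg1 mulgV.
have kc : closed [set x | f x = 1] := closed_preimage fc c1.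
by exists (ClosedNormalSubgroup k1 kM kV kJ kc).
Qed.

Section FundamentalGroup.
Variables (C : finite_group_class) (hC : closed_class C).
Variables (X : finite_graph) (A : proC_graph C X) (T : subgraph X).
Variable Pi : fundamental_group A T.

Definition fg_t (e : edge X) : Pi :=
  fg_quo (fg_inj (f := Pi) (o := None) (fg_basis Pi e)).

Lemma fg_quo_continuous_hom : continuous_hom (@fg_quo _ _ _ _ Pi).
Proof. by case: (fg_quoP Pi). Qed.

Lemma phi_continuous_hom v : continuous_hom (@phi C X A T Pi v).
Proof.
have [_ ci _] := fg_prodP Pi.
exact: continuous_hom_comp (ci (Some v)) fg_quo_continuous_hom.
Qed.

Lemma fundamental_residually : residually_class C Pi.
Proof.
have [pP _ _] := fg_prodP Pi.
apply: (quotient_residually hC (pro_class_residually hC pP) _ (fg_quoP Pi)).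
rewrite (_ : closed_normal_closure _ =
  \bigcap_(N in [set N : closed_normal_subgroup (fg_prod Pi) |
     relators T (fun e => fg_inj (o := None) (fg_basis Pi e))
                   (fun v => fg_inj (o := Some v)) `<=` N]) cns_set N).
  by apply: closed_bigI => N _; exact: cns_closed.
by apply/seteqP; split=> x xS N; exact: xS.
Qed.

Lemma fundamental_generated (S : set Pi) : closed_subgroup S ->
  (forall v g, S (phi Pi (v := v) g)) -> (forall e, S (fg_t e)) -> forall x, S x.
Proof.
move=> [S1 SM SV cS] Sphi St x.
have [[qM qc] qs _ _] := fg_quoP Pi; have [u <-] := qs x.
have preim (G : topGroupType) (f : G -> Pi) : continuous_hom f ->
    closed_subgroup (f @^-1` S).
  move=> [fM fc]; split; rewrite /preimage /=.
  - by rewrite (hom1 fM).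
  - by move=> a b Sa Sb; rewrite fM; exact: SM.
  - by move=> a Sa; rewrite (homV fM); exact: SV.
  - exact: closed_preimage fc cS.
have [_ ci _] := fg_prodP Pi.
apply: (free_proC_product_generated hC (fg_prodP Pi) (preim _ _ fg_quo_continuous_hom)).
move=> [v|] a; first exact: Sphi.
have cN := continuous_hom_comp (ci None) fg_quo_continuous_hom.
exact: (free_proC_generated hC (fg_freeP Pi) (preim _ _ cN)).
Qed.

Lemma fundamental_relation e (g : egroup A e) :
  phi Pi (bd false g) * fg_t e = fg_t e * phi Pi (bd true g).
Proof.
have [[qM qc] qs qK _] := fg_quoP Pi.
have /qK : closed_normal_closure (relators T (fun e => fg_inj (f := Pi) (o := None) (fg_basis Pi e))
                   (fun v => fg_inj (o := Some v)))
    ((fg_inj (o := Some _) (bd false g))^-1 * fg_inj (o := None) (fg_basis Pi e)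
     * fg_inj (o := Some _) (bd true g) * (fg_inj (o := None) (fg_basis Pi e))^-1).
  by move=> N; apply; right; exists e, g.
rewrite !qM !(homV qM) -/(fg_t e) -!/(phi Pi _) => h.
apply: (mulIg (fg_t e)^-1); rewrite mulgK.
apply: (mulgI (phi Pi (bd false g))^-1).
by rewrite mulVg !mulgA h.
Qed.

Lemma fundamental_t1 e : e \in sub_edge T -> fg_t e = 1.
Proof.
move=> eT; have [_ _ qK _] := fg_quoP Pi; apply/qK => N; apply.
by left; exists e.
Qed.

(** The map is built on the free group, then on the free product. Its kernel there is closed and
    normal, so it descends as soon as it kills the relators. *)
Lemma fundamental_hom (H : topGroupType) (h : forall v, vgroup A v -> H)
    (t : edge X -> H) :
  residually_class C H -> (forall v, continuous_hom (@h v)) ->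
  (forall e, e \in sub_edge T -> t e = 1) ->
  (forall e (g : egroup A e), h _ (bd false g) * t e = t e * h _ (bd true g)) ->
  exists f : Pi -> H, [/\ continuous_hom f,
    forall v g, f (phi Pi (v := v) g) = h v g & forall e, f (fg_t e) = t e].
Proof.
move=> hH hh t1 ht; have pH := residually_pro_class hC hH.
have [pF uF] := fg_freeP Pi.
have [k [[hk kt] _]] := uF _ pH t.
have [_ ci uP] := fg_prodP Pi.
pose h0 o : factors A (fg_free Pi) o -> H :=
  match o with Some v => @h v | None => k end.
have hh0 o : continuous_hom (@h0 o) by case: o => [v|] //; exact: hh.
have [m [[[mM mc] mi] _]] := uP _ pH h0 hh0.
have [[qM qc] qs qK qo] := fg_quoP Pi.
have [N NE] := hom_kernel_closed_normal hH (conj mM mc).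
have mK x : fg_quo (f := Pi) x = 1 -> m x = 1.
  move/qK => /(_ N) h1; have : cns_set N x; last by rewrite NE.
  apply: h1; rewrite NE => y [[e eT <-]|[e [g ->]]] /=.
    by rewrite (mi None) /= kt t1.
  rewrite !mM !(homV mM) !(mi None) !(mi (Some _)) /= kt.
  by rewrite -(mulgA (h _ _)^-1) -ht mulKg mulgV.
pose f y := m (projT1 (cid (qs y))).
have fq x : f (fg_quo x) = m x.
  by rewrite /f; case: cid => z /= /(hom_eq qM)/mK /(hom_eq mM).
exists f; split.
- split.
    move=> y y'; have [x <-] := qs y; have [x' <-] := qs y'.
    by rewrite -qM !fq mM.
  apply/continuousP => U oU; apply: qo.
  rewrite (_ : _ @^-1` _ = m @^-1` U); first exact: open_preimage mc oU.
  by apply/seteqP; split=> x; rewrite /= fq.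
- by move=> v g; rewrite fq (mi (Some v)).
- by move=> e; rewrite fq (mi None) /= kt.
Qed.

End FundamentalGroup.

(** * From a homomorphism to tameness *)

(** The complement of [U] is compact and has closed image; by injectivity, the image of [U] is what
    this closed set leaves of the open range. *)
Lemma compact_open_image (X Y : topologicalType) (f : X -> Y) (U : set X) :
  compact [set: X] -> hausdorff_space Y -> continuous f -> injective f ->
  open (range f) -> open U -> open (f @` U).
Proof.
move=> cX hY cf fI oR oU.
rewrite (_ : f @` U = range f `&` ~` (f @` (~` U))).
  apply: openI => //; apply: closed_openC; apply: compact_closed => //.
  apply: continuous_compact; first exact: continuous_subspaceT.
  by apply: (subclosed_compact _ cX) => //; exact: open_closedC.
apply/seteqP; split=> [_ [x Ux <-]|_ [[x _ <-] nx]].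
  by split; [exists x|move=> [y nUy /fI e]; apply: nUy; rewrite e].
by exists x => //; apply: contrapT => nU; apply: nx; exists x.
Qed.

Section Converse.
Variables (C : finite_group_class) (hC : closed_class C).
Variables (X : finite_graph) (A : proC_graph C X) (T : subgraph X).
Hypotheses (hA : commensurating A) (hT : maximal_subtree T).
Variable Pi : fundamental_group A T.
Variables (Q : topGroupType) (psi : Pi -> Q).
Hypotheses (pQ : pro_class C Q) (hpsi : continuous_hom psi).
Hypothesis hv : forall v : vert X,
  injective (fun g : vgroup A v => psi (phi Pi g)) /\
  open (range (fun g : vgroup A v => psi (phi Pi g))).

Let hQ := pro_class_residually hC pQ.
Let psiM : {morph psi : x y / x * y} := proj1 hpsi.
Let phiM v : {morph (@phi _ _ _ _ Pi v) : x y / x * y} := proj1 (phi_continuous_hom Pi v).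

Lemma embedding_tame : tame Pi.
Proof.
have [[V0 cX] oE] := hA; have [r _] := set0Pn _ V0.
have psic v : continuous (fun g : vgroup A v => psi (phi Pi g)).
  exact: (proj2 (continuous_hom_comp (phi_continuous_hom Pi v) hpsi)).
have cG v : compact [set: vgroup A v].
  by case: (pro_class_residually hC (vgroup_proC A v)).
have range1 v : range (fun g : vgroup A v => psi (phi Pi g)) 1.
  by exists 1 => //=; rewrite (hom1 (@phiM v)) (hom1 psiM).
(* One finite quotient of [Q] serves for all vertices and edges because the graph is finite. Edge
   groups enter through [bd false] only; the other embedding is reached by conjugation with
   [fg_t]. *)
have [f0 [f0v f0e]] : exists Hf : {H : finGroupType & Q -> H}, finite_hom C (projT2 Hf) /\
   forall x, projT2 Hf x = 1 ->
     (forall v, range (fun g : vgroup A v => psi (phi Pi g)) x) /\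
     (forall e, range (fun g : egroup A e => psi (phi Pi (bd false g))) x).
  have [_ _ bQ] := hQ.
  pose W := [set x : Q | (forall v, range (fun g : vgroup A v => psi (phi Pi g)) x) /\
     (forall e, range (fun g : egroup A e => psi (phi Pi (bd false g))) x)].
  have nW : nbhs (1 : Q) W.
    apply: filterI; apply: filter_forall => i; apply: open_nbhs_nbhs; split.
    - by case: (hv i).
    - exact: range1.
    - change (open (range (fun g : egroup A i => psi (phi Pi (bd false g))))).
      rewrite (_ : range _ = (fun g => psi (phi Pi g)) @` (range (@bd _ _ A false i))).
        apply: compact_open_image => //.
        + exact: (residually_hausdorff hC hQ).
        + exact: psic.
        + by case: (hv (endpoint false i)).
        + by case: (hv (endpoint false i)).
      by apply/seteqP; split=> [_ [x _ <-]|_ [_ [x _ <-] <-]];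
        [exists (bd false x) => //; exists x|exists x].
    - exists 1 => //=; have [bM _] := bd_hom A false i.
      by rewrite (hom1 bM) (hom1 (@phiM _)) (hom1 psiM).
  have [||H [f [hf fW]]] := bQ (W°).
  - exact: open_interior.
  - exact: nW.
  exists (existT _ H f); split=> // x /fW; exact: interior_subset.
case: f0 f0v f0e => H f /= hf fW; have [fM fo _] := hf.
have phi_inj v : injective (@phi _ _ _ _ Pi v).
  by move=> x y e; apply: (proj1 (hv v)); rewrite /= e.
pose N v := [set x | exists2 g : vgroup A v, f (psi x) = 1 & phi Pi g = x].
have NphiE v (g : vgroup A v) : N v (phi Pi g) <-> f (psi (phi Pi g)) = 1.
  by split=> [[g' e _]|e]; last exists g.
have tE e (g : egroup A e) : phi Pi (bd false g) = fg_t Pi e * phi Pi (bd true g) * (fg_t Pi e)^-1.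
  by rewrite -fundamental_relation mulgK.
have fpsiJ t x : f (psi (t * x * t^-1)) = 1 <-> f (psi x) = 1.
  rewrite !psiM (homV psiM) !fM (homV fM); split=> [e|->]; last by rewrite mulg1 mulgV.
  apply: (mulgI (f (psi t))); apply: (mulIg (f (psi t))^-1); by rewrite e mulg1 mulgV.
have N0 e x : N (endpoint false e) x <->
    exists2 g : egroup A e, f (psi x) = 1 & phi Pi (bd false g) = x.
  split=> [[g fx gx]|[g fx gx]]; last by exists (bd false g).
  have [_ /(_ e)[k _ /= ek]] := fW _ fx; exists k => //; rewrite -gx; congr (phi Pi _).
  by apply: (proj1 (hv _)); rewrite /= ek gx.
(* The conjugate of [x] by [fg_t] still dies under [f], so its image in [Q] comes from the edge
   group through [bd false]. Undoing the conjugation gives an element of [bd true], which must be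
   the given one by injectivity on the vertex group. *)
have N1 e x : N (endpoint true e) x <->
    exists2 g : egroup A e, f (psi x) = 1 & phi Pi (bd true g) = x.
  split=> [[g fx gx]|[g fx gx]]; last by exists (bd true g).
  have /fW[_ /(_ e)[k _ /=]] := iffRL (fpsiJ (fg_t Pi e) x) fx.
  rewrite tE !psiM => /mulIg/mulgI ek.
  exists k => //; rewrite -gx; congr (phi Pi _).
  by apply: (proj1 (hv _)); rewrite /= ek gx.
have NJ e x : N (endpoint true e) x <-> N (endpoint false e) (fg_t Pi e * x * (fg_t Pi e)^-1).
  split=> [/N1[g fx gx]|/N0[g fx gx]].
    by apply/N0; exists g; rewrite ?tE ?gx //; apply/fpsiJ.
  apply/N1; exists g; first exact/fpsiJ/fx.
  by move: gx; rewrite tE => /mulIg/mulgI.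
have NT v w : N v = N w.
  have vT := maximal_subtree_spanning (proj1 hA) hT.
  have [[[_ cT] _] _] := hT; have /connectP[p pp ->] := cT v w (vT v) (vT w).
  elim: p v pp => [|y p IH] v //= /andP[/edge_relP[[e i] [/= eT <- <-]] pp].
  rewrite -(IH _ pp); rewrite /origin /terminus /=.
  have ee : N (endpoint true e) = N (endpoint false e).
    by apply/seteqP; split=> x; rewrite NJ fundamental_t1 // invg1 mulg1 mul1g.
  by clear pp; case: i.
have N1' : N r 1 by exists 1; rewrite ?(hom1 (@phiM r)) ?(hom1 psiM) ?(hom1 fM).
have NM x y : N r x -> N r y -> N r (x * y).
  move=> [g fx gx] [k fy ky]; exists (g * k); last by rewrite phiM gx ky.
  by rewrite psiM fM fx fy mulg1.
have NV x : N r x -> N r x^-1.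
  move=> [g fx gx]; exists g^-1; last by rewrite (homV (@phiM r)) gx.
  by rewrite (homV psiM) (homV fM) fx invg1.
have cN : closed (N r).
  rewrite (_ : N r = phi Pi (v := r) @` [set g | f (psi (phi Pi g)) = 1]).
    apply: (closed_image hC (fundamental_residually hC Pi)).
      exact: (proj2 (phi_continuous_hom Pi r)).
    apply: (subclosed_compact _ (cG r)) => //.
    exact: closed_preimage (psic r) (@finite_hom_closed _ _ _ _ [set 1] hf).
  apply/seteqP; split=> [x [g fx gx]|_ [g fx <-]]; last by exists g.
  by exists g; rewrite //= gx.
(* Stability under [g0] and under its inverse are proved together, so that the elements with this
   property form a closed subgroup and it suffices to look at generators. *)
have NJ' g0 : (forall x, N r x -> N r (g0 * x * g0^-1)) /\
             (forall x, N r x -> N r (g0^-1 * x * g0)).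
  pose S := [set g | (forall x, N r x -> N r (g * x * g^-1)) /\
                     (forall x, N r x -> N r (g^-1 * x * g))].
  apply: (fundamental_generated hC (S := S)).
  - split.
    + by split=> x; rewrite invg1 mul1g mulg1.
    + move=> a b [aJ aJ'] [bJ bJ']; split=> x Nx.
        by have := aJ _ (bJ _ Nx); rewrite invgM !mulgA.
      by have := bJ' _ (aJ' _ Nx); rewrite invgM !mulgA.
    + by move=> a [aJ aJ']; split=> x Nx; rewrite invgK; [exact: aJ'|exact: aJ].
    + rewrite (_ : S = (\bigcap_(x in N r) ((fun g => g * x * g^-1) @^-1` N r)) `&`
         (\bigcap_(x in N r) ((fun g => g^-1 * x * g) @^-1` N r))); last first.
        by apply/seteqP; split=> k [k1 k2]; split=> x Nx; by [exact: k1|exact: k2].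
      have cid := @continuous_idfun Pi.
      apply: closedI; apply: closed_bigI => x Nx; apply: closed_preimage cN.
        apply: continuous_mul; last exact: continuous_inv.
        exact: continuous_rmul.
      apply: continuous_mul => //; apply: continuous_mul; last exact: cst_continuous.
      exact: continuous_inv.
  - have phiJ v g x : N r x -> N r (phi Pi (v := v) g * x * (phi Pi g)^-1).
      rewrite !(NT r v) => -[k fx kx]; exists (g * k * g^-1); first exact/fpsiJ.
      by rewrite !phiM (homV (@phiM v)) kx.
    move=> v g; split; first exact: phiJ.
    by move=> x /(phiJ v g^-1); rewrite (homV (@phiM v)) invgK.
  - move=> e; split=> x.
      by rewrite (NT r (endpoint true e)) => /NJ; rewrite (NT (endpoint false e) (endpoint true e)).
    rewrite [in X in X -> _](NT r (endpoint false e)) (NT r (endpoint true e)) => Nx.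
    by apply/NJ; rewrite mulgA mulgA mulgV mul1g -mulgA mulgV mulg1.
split=> //.
exists (ClosedNormalSubgroup N1' NM NV (fun g => (NJ' g).1) cN) => /=.
have oN v : open (phi Pi (v := v) @^-1` N r).
  rewrite (_ : _ @^-1` _ = (fun g : vgroup A v => psi (phi Pi g)) @^-1` (f @^-1` [set 1])).
    exact: open_preimage (psic v) fo.
  by rewrite (NT r v); apply/seteqP; split=> g /NphiE.
split.
- by move=> v; split; [rewrite (NT r v) => x [g _ <-]; exists g|exact: oN].
- move=> e; split.
    by rewrite (NT r (endpoint false e)) => x /N0[g _ <-]; exists g.
  exact: open_preimage (proj2 (bd_hom A false e)) (oN _).
set NN := ClosedNormalSubgroup _ _ _ _ _.
have psiI x y : N r x -> N r y -> psi x = psi y -> x = y.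
  by move=> [g _ <-] [k _ <-] /(proj1 (hv r)) ->.
(* The element [g'^-1 * g] has the same image in [Q] as some [phi Pi a] in [N]. Since [psi] is
   injective on [N], conjugation by [g] agrees on [N] with conjugation by [g' * phi Pi a], so the
   two classes differ by an inner automorphism. *)
have oc g g' : f (psi g) = f (psi g') ->
    outer_class (conj_on (N := NN) g) `<=` outer_class (conj_on (N := NN) g').
  move=> egg h [ch [n Nn hn]]; split=> //.
  have fg : f (psi (g'^-1 * g)) = 1 by rewrite psiM fM (homV psiM) (homV fM) egg mulVg.
  have [/(_ r)[a _ /= ea] _] := fW _ fg.
  have Na : N r (phi Pi a) by apply/NphiE; rewrite ea.
  exists (phi Pi a * n); first exact: (NM _ _ Na Nn).
  move=> x; rewrite hn; apply: val_inj => /=.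
  have Nx : N r (val x) := set_mem (valP x).
  have NnJ : N r (n * val x * n^-1) by exact: ((NJ' n).1 _ Nx).
  have NaJ : N r (phi Pi a * n * val x * (phi Pi a * n)^-1) by exact: ((NJ' _).1 _ Nx).
  apply: psiI; [exact: ((NJ' g).1 _ NnJ)|exact: ((NJ' g').1 _ NaJ)|].
  have pa : psi (phi Pi a) = (psi g')^-1 * psi g by rewrite ea psiM (homV psiM).
  rewrite !psiM !(homV psiM) !psiM pa.
  by rewrite !invgM invgK !mulgA mulgV mul1g mulgK.
(* By [oc] one representative for each element of [H] suffices; the default 1 is taken for elements
   that are not attained. *)
pose F (h : H) := outer_class (conj_on (N := NN)
   (xget (1 : Pi) [set g | f (psi g) = h])).
apply: (sub_finite_set (B := F @` [set: H])); last first.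
  by apply: finite_image; exact: finite_finset.
move=> _ [g _ <-]; exists (f (psi g)) => //; rewrite /F.
have := @xgetPex _ (1 : Pi) [set g' | f (psi g') = f (psi g)] (ex_intro _ g erefl).
set g' := xget _ _ => /= e; apply/seteqP; split; exact: oc.
Qed.

End Converse.

(** * Wreath products *)

Lemma continuous_pair (X Y Z : topologicalType) (f : X -> Y) (g : X -> Z) :
  continuous f -> continuous g -> continuous (fun x => (f x, g x)).
Proof. by move=> cf cg x; apply: cvg_pair; [exact: cf|exact: cg]. Qed.

Definition wreath (G : groupType) (P : finGroupType) : Type := ({ffun P -> G} * P)%type.

HB.instance Definition _ G P := Choice.copy (wreath G P) ({ffun P -> G} * P)%type.

Section WreathGroup.
Variables (G : groupType) (P : finGroupType).
Implicit Types u v w : wreath G P.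

(** Let [(f, p)] act on pairs by sending [(b, g)] to [(p * b, f b * g)]; the product is composition
    of these maps. In particular a first coordinate obeys a cocycle rule along left translation of
    [P]. *)
Definition wreath_mul u v : wreath G P :=
  ([ffun b => u.1 (v.2 * b) * v.1 b], u.2 * v.2).
Definition wreath_one : wreath G P := ([ffun=> 1], 1).
Definition wreath_inv u : wreath G P := ([ffun b => (u.1 (u.2^-1 * b))^-1], u.2^-1).

Lemma wreath_mulA : associative wreath_mul.
Proof.
move=> u v w; congr pair; last by rewrite /= mulgA.
by apply/ffunP => b; rewrite !ffunE /= !mulgA.
Qed.

Lemma wreath_mul1g : left_id wreath_one wreath_mul.
Proof.
move=> [f p]; congr pair; last by rewrite /= mul1g.
by apply/ffunP => b; rewrite !ffunE /= mul1g.
Qed.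

Lemma wreath_mulg1 : right_id wreath_one wreath_mul.
Proof.
move=> [f p]; congr pair; last by rewrite /= mulg1.
by apply/ffunP => b; rewrite !ffunE /= mul1g mulg1.
Qed.

Lemma wreath_mulVg : left_inverse wreath_one wreath_inv wreath_mul.
Proof.
move=> [f p]; congr pair; last by rewrite /= mulVg.
by apply/ffunP => b; rewrite !ffunE /= mulKg mulVg.
Qed.

Lemma wreath_mulgV : right_inverse wreath_one wreath_inv wreath_mul.
Proof.
move=> [f p]; congr pair; last by rewrite /= mulgV.
by apply/ffunP => b; rewrite !ffunE /= mulgV.
Qed.

HB.instance Definition _ := monoid.isGroup.Build (wreath G P)
  wreath_mulA wreath_mul1g wreath_mulg1 wreath_mulVg wreath_mulgV.

Lemma wreathM u v b : (u * v).1 b = u.1 (v.2 * b) * v.1 b.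
Proof. by rewrite /= ffunE. Qed.

Lemma wreathV u b : (u^-1).1 b = (u.1 (u.2^-1 * b))^-1.
Proof. by rewrite /= ffunE. Qed.

Lemma wreath1 b : (1 : wreath G P).1 b = 1.
Proof. by rewrite /= ffunE. Qed.

Lemma wreath_eq u v : (forall b, u.1 b = v.1 b) -> u.2 = v.2 -> u = v.
Proof. by case: u v => f p [g q] /= /ffunP -> ->. Qed.

End WreathGroup.

HB.instance Definition _ (G P : finGroupType) :=
  Finite.copy (wreath G P) ({ffun P -> G} * P)%type.

Section WreathTopology.
Variables (G : topGroupType) (P : finGroupType).

Definition wreath_coord (w : wreath G P) :
    prod_topology (fun _ : P => G) * discrete_topology P :=
  (fun b => w.1 b, w.2).

HB.instance Definition _ := Topological.copy (wreath G P) (initial_topology wreath_coord).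

Lemma wreath_continuousP (X : topologicalType) (f : X -> wreath G P) :
  (forall b, continuous (fun x => (f x).1 b)) ->
  continuous (fun x => (f x).2 : discrete_topology P) -> continuous f.
Proof.
move=> c1 c2 x U [V [[W oW <-] /= Wx] VU].
apply: filterS VU _.
have cc : continuous (fun x => wreath_coord (f x)).
  have c1' := @continuous_prod X P (fun _ => G) (fun x b => (f x).1 b) c1.
  exact: (continuous_pair c1' c2).
by apply: cc; rewrite nbhsE; exists W.
Qed.

Lemma wreath_fst_continuous b : continuous (fun w : wreath G P => w.1 b).
Proof.
move=> w; have c : continuous (wreath_coord : wreath G P -> _) := @initial_continuous _ _ _.
apply: (@continuous_comp _ _ _ (fun w => (wreath_coord w).1) (fun f => f b)).
  by apply: (@continuous_comp _ _ _ wreath_coord fst); [exact: c|exact: cvg_fst].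
exact: (@proj_continuous P (fun _ => G) b).
Qed.

Lemma wreath_snd_continuous : continuous (fun w : wreath G P => w.2 : discrete_topology P).
Proof.
move=> w; have c : continuous (wreath_coord : wreath G P -> _) := @initial_continuous _ _ _.
by apply: (@continuous_comp _ _ _ wreath_coord snd); [exact: c|exact: cvg_snd].
Qed.

(** The selector [p] is locally constant, so near each point a single [f b] is in force. *)
Lemma discrete_continuous_select (X Y : topologicalType) (p : X -> discrete_topology P)
    (f : P -> X -> Y) :
  continuous p -> (forall b, continuous (f b)) -> continuous (fun x => f (p x) x).
Proof.
move=> cp cf x U nU.
have n1 : nbhs x (p @^-1` [set p x]).
  by apply: cp; rewrite nbhsE; exists [set p x] => //; split=> //; exact: discrete_open.
have n2 : nbhs x (f (p x) @^-1` U) by exact: cf.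
by apply: filterS (filterI n1 n2) => y [/= e fy]; rewrite /= e.
Qed.

Lemma discrete_continuous2 (X : topologicalType) (m : P -> P -> P)
    (p q : X -> discrete_topology P) :
  continuous p -> continuous q ->
  continuous (fun x => m (p x) (q x) : discrete_topology P).
Proof.
move=> cp cq x U nU.
have n1 : nbhs x (p @^-1` [set p x]).
  by apply: cp; rewrite nbhsE; exists [set p x] => //; split=> //; exact: discrete_open.
have n2 : nbhs x (q @^-1` [set q x]).
  by apply: cq; rewrite nbhsE; exists [set q x] => //; split=> //; exact: discrete_open.
apply: filterS (filterI n1 n2) => y [/= e1 e2]; rewrite /= e1 e2.
exact: nbhs_singleton nU.
Qed.

Lemma wreath_mul_continuous :
  continuous (fun uv : wreath G P * wreath G P => uv.1 * uv.2).
Proof.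
have c1 : continuous (fun uv : wreath G P * wreath G P => uv.1) by move=> x; exact: cvg_fst.
have c2 : continuous (fun uv : wreath G P * wreath G P => uv.2) by move=> x; exact: cvg_snd.
have cc (Y : topologicalType) (f : wreath G P * wreath G P -> wreath G P) (g : wreath G P -> Y) :
    continuous f -> continuous g -> continuous (fun x => g (f x)).
  by move=> cf cg x; apply: continuous_comp; [exact: cf|exact: cg].
apply: wreath_continuousP => [b|].
  have -> : (fun x : wreath G P * wreath G P => (x.1 * x.2).1 b) =
      fun x => x.1.1 (x.2.2 * b) * x.2.1 b.
    by apply/funext => x; exact: wreathM.
  apply: continuous_mul; last exact: cc c2 (@wreath_fst_continuous b).
  apply: (@discrete_continuous_select (wreath G P * wreath G P)%type G (fun x => x.2.2)
    (fun p x => x.1.1 ((p : P) * b))).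
    exact: cc c2 wreath_snd_continuous.
  by move=> p; exact: cc c1 (@wreath_fst_continuous _).
have h1 := cc _ _ _ c1 wreath_snd_continuous.
have h2 := cc _ _ _ c2 wreath_snd_continuous.
exact: (@discrete_continuous2 _ (fun x y => x * y) _ _ h1 h2).
Qed.

Lemma wreath_inv_continuous : continuous (fun u : wreath G P => u^-1).
Proof.
apply: wreath_continuousP => [b|].
  have -> : (fun x : wreath G P => (x^-1).1 b) = fun x => (x.1 (x.2^-1 * b))^-1.
    by apply/funext => x; exact: wreathV.
  apply: continuous_inv.
  apply: (@discrete_continuous_select (wreath G P) G (fun x : wreath G P => x.2)
            (fun p (x : wreath G P) => x.1 ((p : P)^-1 * b))).
    exact: wreath_snd_continuous.
  by move=> p; exact: wreath_fst_continuous.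
have h := wreath_snd_continuous.
exact: (@discrete_continuous2 _ (fun x _ => x^-1) _ _ h h).
Qed.

HB.instance Definition _ := isTopologicalGroup.Build (wreath G P)
  wreath_mul_continuous wreath_inv_continuous.

End WreathTopology.

Section WreathClass.
Variables (C : finite_group_class) (hC : closed_class C).

Lemma class_embed (K H : finGroupType) (f : K -> H) :
  {morph f : x y / x * y} -> injective f -> C [set: H]%G -> C [set: K]%G.
Proof.
move=> fM fI CH; pose fm := @Morphism _ _ [set: K]%SET f (fun x y _ _ => fM x y).
have inj : 'injm fm by apply/injmP => x y _ _ /fI.
have iso : (fm @* [set: K])%G \isog [set: K]%G.
  by rewrite isog_sym; exact: (sub_isog (finset.subsetT _) inj).
by apply: (class_isog hC iso); apply: (class_sub hC) CH; exact: finset.subsetT.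
Qed.

Lemma class_sep (K H : finGroupType) (I : finType) (e : I -> K -> H) :
  C [set: H]%G -> (forall i, {morph e i : x y / x * y}) ->
  (forall x, (forall i, e i x = 1) -> x = 1) -> C [set: K]%G.
Proof.
move=> CH eM eI.
have he i : finite_hom C (e i : discrete_group K -> H).
  by split=> //; exact: (@discrete_group_open K).
have [|L [f [[fM _ CL] fe]]] := finite_hom_seq hC (enum I) _ he.
  exists H, (fun _ => 1); split=> //; first by move=> x y; rewrite mulg1.
apply: (class_embed fM) CL => x y /(hom_eq fM)/fe h.
apply/esym/(@mulgI K x^-1); rewrite mulVg; apply: eI => i.
by apply: h; rewrite mem_enum.
Qed.

(** The kernel of the projection to [P] is separated by its coordinates, which are homomorphisms to
    [H]; the extension by [P] stays in the class. *)
Lemma class_wreath (H P : finGroupType) :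
  C [set: H]%G -> C [set: P]%G -> C [set: wreath H P]%G.
Proof.
move=> CH CP.
have sM : {in [set: wreath H P]%SET &, {morph (fun w : wreath H P => w.2) : x y / x * y}} by [].
pose fm := Morphism sM.
apply: (class_ext hC (ker_normal fm)); last first.
  apply: (class_isog hC) CP; rewrite isog_sym; apply: isog_trans (first_isog fm) _.
  suff -> : [set: P]%G = (fm @* [set: wreath H P])%G by exact: isog_refl.
  apply/val_inj/esym/setP => p; rewrite finset.in_setT.
  exact: (mem_morphim fm (finset.in_setT (([ffun=> 1], p) : wreath H P)) (finset.in_setT _)).
apply: (class_isog hC (G := [set: subg_of ('ker fm)]%G)).
  by rewrite isog_sym; exact: isog_subg.
apply: (class_sep (e := fun (b : P) (w : subg_of ('ker fm)) => (sgval w).1 b) CH).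
- move=> b x y /=; rewrite ffunE; congr (_ * _).
  by have /mker /= -> := subgP y; rewrite mul1g.
- move=> w w1; apply/val_inj; apply: wreath_eq.
    by move=> b; rewrite wreath1; exact: w1.
  by have /mker /= -> := subgP w.
Qed.

(** A nontrivial element shows either in [P] or in one coordinate. In the second case a finite
    quotient of [G] that detects the coordinate is applied to all coordinates at once, with values
    in a finite wreath product. *)
Lemma wreath_residually (G : topGroupType) (P : finGroupType) :
  residually_class C G -> C [set: P]%G -> residually_class C (wreath G P).
Proof.
move=> hG CP; have [cG _ _] := hG.
have open_snd (U : set P) : open [set w : wreath G P | U w.2].
  apply: (@open_preimage _ (discrete_topology P) (fun w : wreath G P => w.2) U).
    exact: wreath_snd_continuous.
  exact: discrete_open.
have hs : finite_hom C (fun w : wreath G P => w.2).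
  by split=> //; exact: (open_snd [set 1]).
apply: (residually_class_sep hC).
- pose g (fp : prod_topology (fun _ : P => G) * discrete_topology P) : wreath G P :=
    ([ffun b => fp.1 b], fp.2).
  have cg : continuous g.
    apply: wreath_continuousP => [b|]; last by move=> x; exact: cvg_snd.
    have -> : (fun x => (g x).1 b) = fun x => x.1 b by apply/funext => x; rewrite ffunE.
    move=> x; apply: (@continuous_comp _ _ _ fst (fun f : prod_topology (fun _ : P => G) => f b)).
      exact: cvg_fst.
    exact: (@proj_continuous P (fun _ => G) b).
  rewrite (_ : [set: wreath G P] = g @` ([set: prod_topology (fun _ : P => G)] `*` [set: discrete_topology P])).
    apply: continuous_compact; first exact: continuous_subspaceT.
    apply: compact_setX; last by apply: finite_compact; exact: (@finite_finset P).
    have := @tychonoff P (fun _ => G) (fun _ => [set: G]) (fun _ => cG).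
    by rewrite (_ : mkset _ = setT) //; apply/seteqP; split.
  apply/seteqP; split=> // w _; exists (fun b => w.1 b, w.2) => //.
  by apply: wreath_eq => // b; rewrite ffunE.
- by exists P, (fun w => w.2).
- move=> w w1; have [w2|w2] := eqVneq w.2 1; last first.
    by exists P, (fun w => w.2); split=> //; exact/eqP.
  have [b wb] : exists b, w.1 b <> 1.
    apply: contrapT => nb; apply: w1; apply: wreath_eq => // b.
    by rewrite wreath1; apply: contrapT => wb; apply: nb; exists b.
  have [H [f [hf fwb]]] := separate_points hC hG wb.
  have [fM fo CH] := hf.
  exists (wreath H P), (fun w : wreath G P => ([ffun b => f (w.1 b)], w.2) : wreath H P); split.
    split; last exact: class_wreath.
      move=> x y; apply: wreath_eq => // c.
      by rewrite wreathM /= !ffunE /= fM.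
    rewrite (_ : _ @^-1` _ = [set w : wreath G P | w.2 = 1] `&`
       \bigcap_(b in [set: P]) [set w : wreath G P | f (w.1 b) = 1]).
      apply: openI; first exact: (open_snd [set 1]).
      rewrite -closedC setC_bigcap; apply: closed_bigcup; first exact: finite_finset.
      move=> c _; apply: open_closedC.
      exact: (open_preimage (@wreath_fst_continuous G P c) fo).
    apply/seteqP; split=> [x /= e|x [/= x2 x1]].
      split=> [|c _ /=]; first exact: (congr1 snd e).
      have := congr1 (fun u : wreath H P => u.1 c) e.
      by rewrite wreath1 /= ffunE.
    apply: wreath_eq => //= c; rewrite !ffunE; exact: x1.
  move=> /(congr1 (fun u : wreath H P => u.1 b)); rewrite wreath1 /= ffunE => e.
  by apply: fwb; rewrite e (hom1 fM).
Qed.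

End WreathClass.

(** * Splitting the quotient by N *)

Lemma discrete_continuous_comp (X Y : topologicalType) (P : finGroupType)
    (p : X -> P) (m : P -> Y) :
  continuous (p : X -> discrete_topology P) -> continuous (fun x => m (p x)).
Proof.
move=> cp; apply: (@discrete_continuous_select P X Y p (fun b _ => m b) cp) => b.
exact: cst_continuous.
Qed.

Lemma closed_discrete_point (P : finGroupType) (b : P) :
  closed ([set b] : set (discrete_topology P)).
Proof. rewrite -[X in closed X]setCK; apply: open_closedC; exact: discrete_open. Qed.

Lemma rcoset_repr_decomp (P : finGroupType) (B : {group P}) (b : P) :
  exists2 h, h \in B & b = h * repr (B :* b).
Proof.
have /rcosetP[h hB e] := mem_repr_rcoset B b.
by exists h^-1; rewrite ?groupV // e mulKg.
Qed.

Lemma rcoset_repr_mul (P : finGroupType) (B : {group P}) (h b : P) :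
  h \in B -> repr (B :* (h * b)) = repr (B :* b).
Proof. by move=> hB; rewrite rcosetM (rcoset_id hB). Qed.

Section Splitting.
Variables (C : finite_group_class) (hC : closed_class C).
Variables (X : finite_graph) (A : proC_graph C X) (T : subgraph X).
Hypothesis hT : acyclic (sub_edge T).
Variable Pi : fundamental_group A T.
Variables (N D : closed_normal_subgroup Pi) (P : finGroupType) (q : Pi -> P).
Hypotheses (hq : finite_hom C q) (qs : forall b, exists x, q x = b).
Hypothesis qN : forall x, cns_set N x -> q x = 1.
Hypothesis phiN : forall v (g : vgroup A v), q (phi Pi g) = 1 -> cns_set N (phi Pi g).
Hypothesis rangeN : exists v, N `<=` range (phi Pi (v := v)).
Hypothesis kerND : forall x, q x = 1 ->
  exists n d, [/\ cns_set N n, cns_set D d & x = n * d].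

Let qM : {morph q : x y / x * y} := let: And3 h _ _ := hq in h.
Let phiM v : {morph (@phi _ _ _ _ Pi v) : x y / x * y} :=
  proj1 (phi_continuous_hom Pi v).

Let RN := coset_space N.
Let RD := coset_space D.
Let pN : Pi -> RN := @coset_pi Pi N.
Let pD : Pi -> RD := @coset_pi Pi D.
Let pNM : {morph pN : x y / x * y}. Proof. by move=> x y; apply/esym; exact: coset_piM. Qed.
Let pDM : {morph pD : x y / x * y}. Proof. by move=> x y; apply/esym; exact: coset_piM. Qed.
Let pNV x : pN x^-1 = (pN x)^-1 := homV pNM x.
Let pDV x : pD x^-1 = (pD x)^-1 := homV pDM x.

Let pN1 x : pN x = 1 <-> cns_set N x.
Proof.
rewrite -[1](hom1 pNM) coset_piP mulg1.
by split=> /cnsV; rewrite ?invgK.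
Qed.

Let pD1 x : pD x = 1 <-> cns_set D x.
Proof.
rewrite -[1](hom1 pDM) coset_piP mulg1.
by split=> /cnsV; rewrite ?invgK.
Qed.

(** As the kernel of [q] lies in the product of [N] and [D], a class modulo [N] and a class modulo
    [D] can be prescribed together whenever they agree in [P]. *)
Let chinese_remainder a b : q a = q b -> exists c, pN c = pN a /\ pD c = pD b.
Proof.
move=> qab; have [|n [d [Nn Dd e]]] := @kerND (a * b^-1).
  by rewrite qM (homV qM) qab mulgV.
exists (d * b); split.
  rewrite (_ : d * b = n^-1 * a).
    by rewrite pNM pNV (iffRL (pN1 n) Nn) invg1 mul1g.
  by rewrite -[a](mulgVK b) e -mulgA mulKg.
by rewrite pDM (iffRL (pD1 d) Dd) mul1g.
Qed.

Let y (b : P) : Pi := projT1 (cid (qs b)).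
Let qy b : q (y b) = b. Proof. exact: (projT2 (cid (qs b))). Qed.

(* The condition modulo [D] forces the homomorphism to send [ker q] into [D]. *)
Let lies_over (x : Pi) (w : wreath Pi P) : Prop :=
  w.2 = q x /\ forall b, pN (w.1 b) = pN x /\
                         pD (w.1 b) = pD (y (q x * b)) * (pD (y b))^-1.

Let lies_over1 : lies_over 1 1.
Proof.
split; first by rewrite (hom1 qM).
by move=> b; rewrite wreath1 (hom1 pNM) (hom1 pDM) (hom1 qM) mul1g mulgV.
Qed.

Let lies_overM x x' w w' : lies_over x w -> lies_over x' w' ->
  lies_over (x * x') (w * w').
Proof.
move=> [w2 w1] [w2' w1']; split; first by rewrite qM -w2 -w2'.
move=> b; rewrite wreathM w2'.
rewrite !pNM !pDM qM; have [-> ->] := w1 (q x' * b); have [-> ->] := w1' b.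
by split=> //; rewrite !mulgA mulgVK.
Qed.

Let lies_overV x w : lies_over x w -> lies_over x^-1 w^-1.
Proof.
move=> [w2 w1]; split; first by rewrite (homV qM) -w2.
move=> b; rewrite wreathV !pNV !pDV w2 (homV qM).
have [-> ->] := w1 ((q x)^-1 * b); rewrite mulKVg.
by split=> //; rewrite invgM invgK.
Qed.

Let vertex_image_group v : group_set [set b : P | `[<exists g : vgroup A v, q (phi Pi g) = b>]]%SET.
Proof.
apply/group_setP; split.
  by rewrite finset.inE; apply/asboolP; exists 1; rewrite (hom1 (@phiM v)) (hom1 qM).
move=> a b; rewrite !finset.inE => /asboolP[g <-] /asboolP[h <-].
by apply/asboolP; exists (g * h); rewrite phiM qM.
Qed.

Let vertex_image v : {group P} := Group (vertex_image_group v).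

Let vertex_imageP v b : b \in vertex_image v <-> exists g : vgroup A v, q (phi Pi g) = b.
Proof. by rewrite finset.inE; split=> /asboolP. Qed.

(** The orbits of the vertex group on [P] are the cosets [vertex_image v :* b]. A class modulo [N]
    chosen at one point of an orbit spreads over it without ambiguity, because an element of the
    vertex group that fixes a point of [P] lies in [N]. The class modulo [D] is kept equal to that
    of [y]. *)
Let vertex_section v : exists yv : P -> Pi,
  (forall b, pD (yv b) = pD (y b)) /\
  forall (g : vgroup A v) b, pN (yv (q (phi Pi g) * b)) = pN (phi Pi g) * pN (yv b).
Proof.
pose r b := repr (vertex_image v :* b).
have /choice[yv yvP] : forall b, exists w, pD w = pD (y b) /\
   exists g : vgroup A v, q (phi Pi g) * r b = b /\ pN w = pN (phi Pi g * y (r b)).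
  move=> b; have [h /vertex_imageP[g gh] bh] := rcoset_repr_decomp (vertex_image v) b.
  have [|w [wN wD]] := @chinese_remainder (phi Pi g * y (r b)) (y b).
    by rewrite qM !qy gh -bh.
  by exists w; split=> //; exists g; rewrite gh -bh.
exists yv; split=> [b|g b]; first by case: (yvP b).
have [_ [h [hb ->]]] := yvP b; have [_ [k [kb ->]]] := yvP (q (phi Pi g) * b).
have rb : r (q (phi Pi g) * b) = r b.
  by apply: rcoset_repr_mul; apply/vertex_imageP; exists g.
rewrite rb in kb *; rewrite -[in LHS](mulgVK (phi Pi (g * h)) (phi Pi k)).
rewrite -[in LHS](homV (@phiM v)) -[in LHS]phiM -mulgA [LHS]pNM.
have -> : pN (phi Pi (k * (g * h)^-1)) = 1.
  apply/pN1/phiN; rewrite !(phiM, qM, homV (@phiM v), homV qM).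
  apply/eqP; rewrite divg_eq1; apply/eqP/(mulIg (r b)).
  by rewrite kb -mulgA hb.
by rewrite mul1g phiM -mulgA !pNM.
Qed.

Let ys v : P -> Pi := projT1 (cid (vertex_section v)).
Let ysD v b : pD (ys v b) = pD (y b).
Proof. by case: (projT2 (cid (vertex_section v))) => h _; exact: h. Qed.
Let ysN v (g : vgroup A v) b :
  pN (ys v (q (phi Pi g) * b)) = pN (phi Pi g) * pN (ys v b).
Proof. by case: (projT2 (cid (vertex_section v))) => _ h; exact: h. Qed.

(** The coboundary of the section [ys v]. It depends on [g] only through [q], so it is trivial on
    [N]; equivariance of [ys v] modulo [N] puts it over [phi Pi g]. *)
Let vertex_map v (g : vgroup A v) : wreath Pi P :=
  ([ffun b => ys v (q (phi Pi g) * b) * (ys v b)^-1], q (phi Pi g)).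

Let vertex_mapE v (g : vgroup A v) b :
  (vertex_map g).1 b = ys v (q (phi Pi g) * b) * (ys v b)^-1.
Proof. by rewrite /= ffunE. Qed.

Let vertex_map_hom v : continuous_hom (@vertex_map v).
Proof.
have cq : continuous (fun g : vgroup A v => q (phi Pi g) : discrete_topology P).
  move=> g; apply: (@continuous_comp _ _ _ (@phi _ _ _ _ Pi v) (q : Pi -> discrete_topology P)).
    exact: (proj2 (phi_continuous_hom Pi v)).
  by have [_ c] := finite_hom_continuous hq; exact: c.
split.
  move=> g h; apply: wreath_eq; last by rewrite /= phiM qM.
  move=> b; rewrite wreathM !vertex_mapE phiM qM /= -[in LHS]mulgA.
  by rewrite [RHS]mulgA mulgVK.
apply: wreath_continuousP => [b|]; last exact: cq.
have -> : (fun x => (vertex_map x).1 b) = fun x : vgroup A v =>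
   (fun c => ys v (c * b) * (ys v b)^-1) (q (phi Pi x)).
  by apply/funext => x; exact: vertex_mapE.
exact: (@discrete_continuous_comp _ _ P _ (fun c => ys v (c * b) * (ys v b)^-1) cq).
Qed.

Let vertex_map_over v (g : vgroup A v) : lies_over (phi Pi g) (vertex_map g).
Proof.
split=> // b; rewrite vertex_mapE pNM pDM pNV pDV ysN !ysD.
by rewrite mulgK.
Qed.

Let edge_image_group e :
  group_set [set b : P | `[<exists g : egroup A e, q (phi Pi (bd true g)) = b>]]%SET.
Proof.
have [bM _] := bd_hom A true e; apply/group_setP; split.
  rewrite finset.inE; apply/asboolP; exists 1.
  by rewrite (hom1 bM) (hom1 (@phiM _)) (hom1 qM).
move=> a b; rewrite !finset.inE => /asboolP[g <-] /asboolP[h <-].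
by apply/asboolP; exists (g * h); rewrite bM phiM qM.
Qed.

Let edge_image e : {group P} := Group (edge_image_group e).

Let edge_imageP e b :
  b \in edge_image e <-> exists g : egroup A e, q (phi Pi (bd true g)) = b.
Proof. by rewrite finset.inE; split=> /asboolP. Qed.

(** For [w] of the form [y0 (q t * b) * kappa b * (y1 b)^-1] the edge relation says exactly that
    [kappa] is constant on the orbits of the edge group. So [kappa] is computed at the
    representative [r b], from an element [s] with the classes that [lies_over] asks for, and the
    equivariance of [y0] and [y1] modulo [N] carries the condition to the whole orbit. *)
Let edge_element e : exists w : wreath Pi P, lies_over (fg_t Pi e) w /\
  forall g : egroup A e, vertex_map (bd false g) * w = w * vertex_map (bd true g).
Proof.
set t := fg_t Pi e; pose y0 := ys (endpoint false e); pose y1 := ys (endpoint true e).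
have tg (g : egroup A e) b :
    q (phi Pi (bd false g)) * (q t * b) = q t * (q (phi Pi (bd true g)) * b).
  by rewrite !mulgA -!qM fundamental_relation.
pose r b := repr (edge_image e :* b).
have /choice[s sP] : forall b, exists s, pN s = pN t /\
    pD s = pD (y (q t * b)) * (pD (y b))^-1.
  move=> b; have [|s [sN sD]] := @chinese_remainder t (y (q t * b) * (y b)^-1).
    by rewrite qM (homV qM) !qy mulgK.
  by exists s; rewrite sN sD pDM pDV.
pose kappa b := (y0 (q t * r b))^-1 * s (r b) * y1 (r b).
pose w : wreath Pi P := ([ffun b => y0 (q t * b) * kappa b * (y1 b)^-1], q t).
have wE b : w.1 b = y0 (q t * b) * kappa b * (y1 b)^-1 by rewrite /= ffunE.
exists w; split.
  split=> // b; rewrite wE /kappa; have [sN sD] := sP (r b).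
  rewrite !(pNM, pDM, pNV, pDV) sN sD !ysD; split; last first.
    by rewrite mulKg mulVg mulg1.
  have [h /edge_imageP[g gh] bh] := rcoset_repr_decomp (edge_image e) b.
  rewrite -/(r b) in bh; have -> : y0 (q t * b) = y0 (q (phi Pi (bd false g)) * (q t * r b)).
    by rewrite tg gh -bh.
  have -> : y1 b = y1 (q (phi Pi (bd true g)) * r b) by rewrite gh -bh.
  rewrite !ysN invgM !mulgA mulgK mulgK.
  by rewrite -[X in X * _]pNM (fundamental_relation Pi g) pNM mulgK.
move=> g; apply: wreath_eq; last by have := tg g 1; rewrite !mulg1.
move=> b; rewrite !wreathM !wE !vertex_mapE [w.2]/= tg.
have -> : kappa (q (phi Pi (bd true g)) * b) = kappa b.
  rewrite /kappa (_ : r _ = r b) //.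
  by apply: rcoset_repr_mul; apply/edge_imageP; exists g.
by rewrite !mulgA mulgVK mulgVK.
Qed.

Let wPi : residually_class C (wreath Pi P).
Proof.
apply: wreath_residually => //; first exact: fundamental_residually.
by case: hq.
Qed.

Lemma exists_splitting : exists s : P -> Pi -> Pi,
  [/\ forall b, continuous (s b),
      forall b x x', s b (x * x') = s (q x' * b) x * s b x',
      forall b n, cns_set N n -> s b n = 1,
      forall b x, cns_set N (s b x * x^-1)
    & forall b x, q x = 1 -> cns_set D (s b x)].
Proof.
pose t e := projT1 (cid (edge_element e)).
have tP e : lies_over (fg_t Pi e) (t e) /\
  forall g : egroup A e, vertex_map (bd false g) * t e = t e * vertex_map (bd true g).
  exact: (projT2 (cid (edge_element e))).
(* On the tree the elements [t e] lie over 1 but need not equal 1, as the relators demand. Twisting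
   the vertex maps by elements [z v] that lie over 1 trivialises them and preserves [lies_over]. *)
have [||||z [zS zt]] := @forest_potential _ (wreath Pi P) (lies_over 1) _ t _ _ _ hT.
- exact: lies_over1.
- by move=> u v hu hv; have := lies_overM hu hv; rewrite mulg1.
- by move=> u hu; have := lies_overV hu; rewrite invg1.
- by move=> e /fundamental_t1 <-; case: (tP e).
pose h v (g : vgroup A v) : wreath Pi P := z v * vertex_map g * (z v)^-1.
pose t' e := z (endpoint false e) * t e * (z (endpoint true e))^-1.
have [|e eT|e g|Th [Thc Thv Tht]] := @fundamental_hom C hC X A T Pi (wreath Pi P) h t' wPi.
- move=> v; have [vM vc] := vertex_map_hom v; split.
    by move=> g k; rewrite /h vM !mulgA mulgVK.
  apply: continuous_mul; last exact: cst_continuous.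
  by apply: continuous_mul => //; exact: cst_continuous.
- exact: zt.
- rewrite /h /t' !mulgA !mulgVK -[z _ * _ * t e]mulgA (proj2 (tP e)).
  by rewrite !mulgA.
have [ThM _] := Thc.
have cTh b : continuous (fun x => (Th x).1 b).
  move=> x; apply: (@continuous_comp _ _ _ Th (fun w => w.1 b)); first exact: (proj2 Thc).
  exact: wreath_fst_continuous.
have cT2 : continuous (fun x => (Th x).2 : discrete_topology P).
  move=> x; apply: (@continuous_comp _ _ _ Th (fun w => w.2 : discrete_topology P)).
    exact: (proj2 Thc).
  exact: wreath_snd_continuous.
have cq : continuous (q : Pi -> discrete_topology P).
  by have [_ c] := finite_hom_continuous hq; exact: c.
have over : forall x, lies_over x (Th x).
  pose S := [set x | lies_over x (Th x)].
  apply: (fundamental_generated hC (S := S)).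
  - split.
    + by rewrite /S /= (hom1 ThM); exact: lies_over1.
    + by move=> a b Sa Sb; rewrite /S /= ThM; exact: lies_overM.
    + by move=> a Sa; rewrite /S /= (homV ThM); exact: lies_overV.
    + rewrite (_ : S = [set x | (Th x).2^-1 * q x = 1] `&`
         ((\bigcap_b [set x | cns_set N ((Th x).1 b * x^-1)]) `&`
          (\bigcap_b [set x | cns_set D ((Th x).1 b * (y b * (y (q x * b))^-1))]))).
        have c2 := @discrete_continuous2 P Pi (fun a b => a^-1 * b) _ _ cT2 cq.
        apply: closedI; first exact: (closed_preimage c2 (@closed_discrete_point P 1)).
        apply: closedI; apply: closed_bigI => b _.
          apply: (@closed_preimage _ _ (fun x => (Th x).1 b * x^-1) N); last exact: cns_closed.
          by apply: continuous_mul => //; apply: continuous_inv; exact: continuous_idfun.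
        apply: (@closed_preimage _ _ (fun x => (Th x).1 b * (y b * (y (q x * b))^-1)) D);
          last exact: cns_closed.
        apply: continuous_mul => //.
        exact: (@discrete_continuous_comp _ _ P _ (fun c => y b * (y (c * b))^-1) cq).
      apply/seteqP; split=> [x [x2 x1]|x [/= x2 [xN xD]]].
        split; first by rewrite /= x2 mulVg.
        split=> b _; rewrite /=; have [bN bD] := x1 b.
          by apply/pN1; rewrite pNM pNV bN mulgV.
        by apply/pD1; rewrite !pDM pDV bD !mulgA mulgVK mulgV.
      split; first by rewrite -[LHS]mulg1 -x2 mulKVg.
      move=> b; have /pN1 := xN b I; have /pD1 := xD b I; rewrite !pNM !pDM pNV pDV.
      move=> e1 /divg1_eq ->; split=> //.
      by rewrite -[LHS]mulg1 -[X in _ * X](mulgV (pD (y b) * (pD (y (q x * b)))^-1)) mulgA e1 mul1g invgM invgK.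
  - move=> v g; rewrite /S /= Thv /h.
    have := lies_overM (lies_overM (zS v) (vertex_map_over g)) (lies_overV (zS v)).
    by rewrite mul1g invg1 mulg1.
  - move=> e; rewrite /S /= Tht /t'.
    have := lies_overM (lies_overM (zS _) (proj1 (tP e))) (lies_overV (zS (endpoint true e))).
    by move=> /(_ (endpoint false e)); rewrite mul1g invg1 mulg1.
exists (fun b x => (Th x).1 b); split.
- exact: cTh.
- move=> b x x'; rewrite ThM wreathM; by have [-> _] := over x'.
- move=> b n Nn; have [v /(_ n Nn)[g _ gn]] := rangeN.
  rewrite -gn Thv /h (_ : vertex_map g = 1) ?mulg1 ?mulgV ?wreath1 //.
  apply: wreath_eq; last by rewrite /= gn qN.
  by move=> c; rewrite vertex_mapE wreath1 gn qN // mul1g mulgV.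
- move=> b x; apply/pN1; rewrite pNM pNV; have [_ /(_ b)[-> _]] := over x.
  exact: mulgV.
- move=> b x qx; apply/pD1; have [_ /(_ b)[_ ->]] := over x.
  by rewrite qx mul1g mulgV.
Qed.

End Splitting.

(** * Closed normal subgroups and finite index *)

(** Elements with a common label lie in one left coset of [S], so the complement of [S] is a finite
    union of closed cosets. A relation is used because an element may carry several labels. *)
Lemma finite_index_open (G : topGroupType) (S : set G) (U : Type) (F : set U)
    (R : G -> U -> Prop) :
  closed_subgroup S -> finite_set F ->
  (forall g, exists2 u, F u & R g u) ->
  (forall g g' u, R g u -> R g' u -> S (g'^-1 * g)) ->
  open S.
Proof.
move=> [S1 SM SV cS] fF RF RS.
rewrite -closedC.
have -> : ~` S = \bigcup_(u in F) [set x | exists g, [/\ R g u, ~ S g & S (g^-1 * x)]].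
  apply/seteqP; split=> [x nSx|x [u _ [g [gu nSg Sgx]]] Sx].
    have [u Fu xu] := RF x; exists u => //; exists x; split=> //.
    by rewrite mulVg.
  by apply: nSg; have := SM _ _ Sx (SV _ Sgx); rewrite invgM invgK mulVKg.
apply: (@closed_bigcup _ {classic U} F) => // u _.
have [[g [gu nSg]]|ng] := pselect (exists g, R g u /\ ~ S g); last first.
  rewrite (_ : mkset _ = set0); first exact: closed0.
  by apply/seteqP; split=> // x [g [gu nSg _]]; apply: ng; exists g.
rewrite (_ : mkset _ = (fun x => g^-1 * x) @^-1` S).
  exact: closed_preimage (continuous_lmul _) cS.
apply/seteqP; split=> [x [g' [gu' _ Sx]]|x Sx]; last by exists g.
by have := SM _ _ (RS g' g u gu' gu) Sx; rewrite -mulgA mulVKg.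
Qed.

Lemma open_translates (G : topGroupType) (S U : set G) :
  open S -> S 1 -> (forall x s, U x -> S s -> U (x * s)) -> open U.
Proof.
move=> oS S1 US.
have -> : U = \bigcup_(x in U) ((fun y => x^-1 * y) @^-1` S).
  apply/seteqP; split=> [x Ux|y [x Ux /= Sxy]].
    by exists x => //=; rewrite mulVg.
  by rewrite -[y](mulKVg x) mulVKg -[y](mulVKg x); exact: US.
by apply: bigcup_open => x _; exact: open_preimage (continuous_lmul _) oS.
Qed.

Lemma closed_normal_product (C : finite_group_class) (hC : closed_class C)
    (G : topGroupType) (M N : closed_normal_subgroup G) :
  residually_class C G ->
  exists J : closed_normal_subgroup G,
    forall x, cns_set J x <-> exists m n, [/\ cns_set M m, cns_set N n & x = m * n].
Proof.
move=> hG; pose S := [set x : G | exists m n, [/\ cns_set M m, cns_set N n & x = m * n]].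
have S1 : S 1 by exists 1, 1; rewrite mulg1; split=> //; exact: cns1.
have SM x y : S x -> S y -> S (x * y).
  move=> [m [n [Mm Nn ->]]] [m' [n' [Mm' Nn' ->]]].
  exists (m * (n * m' * n^-1)), (n * n'); split; last by rewrite !mulgA mulgVK.
    by apply: cnsM => //; exact: cnsJ.
  exact: cnsM.
have SV x : S x -> S x^-1.
  move=> [m [n [Mm Nn ->]]]; exists (n^-1 * m^-1 * n), n^-1; split.
  - by have := cnsJ n^-1 (cnsV Mm); rewrite invgK.
  - exact: cnsV.
  - by rewrite invgM mulgK.
have SJ g x : S x -> S (g * x * g^-1).
  move=> [m [n [Mm Nn ->]]]; exists (g * m * g^-1), (g * n * g^-1).
  by split; [exact: cnsJ|exact: cnsJ|rewrite !mulgA mulgVK].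
have Scl : closed S.
  have [cG _ _] := hG.
  have -> : S = (fun p : G * G => p.1 * p.2) @` (M `*` N).
    apply/seteqP; split=> [x [m [n [Mm Nn ->]]]|_ [[m n] [/= Mm Nn] <-]].
      by exists (m, n).
    by exists m, n.
  apply: (closed_image hC hG); first exact: mulg_continuous.
  by apply: compact_setX; apply: (subclosed_compact _ cG) => //; exact: cns_closed.
by exists (ClosedNormalSubgroup S1 SM SV SJ Scl).
Qed.

Lemma closed_normal_intersection (G : topGroupType) (M N : closed_normal_subgroup G) :
  exists J : closed_normal_subgroup G, cns_set J = M `&` N.
Proof.
have S1 : (M `&` N) 1 by split; exact: cns1.
have SM x y : (M `&` N) x -> (M `&` N) y -> (M `&` N) (x * y).
  by move=> [? ?] [? ?]; split; exact: cnsM.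
have SV x : (M `&` N) x -> (M `&` N) x^-1 by move=> [? ?]; split; exact: cnsV.
have SJ g x : (M `&` N) x -> (M `&` N) (g * x * g^-1).
  by move=> [? ?]; split; exact: cnsJ.
have Scl : closed (M `&` N) by apply: closedI; exact: cns_closed.
by exists (ClosedNormalSubgroup S1 SM SV SJ Scl).
Qed.

Lemma closed_normal_centralizer (C : finite_group_class)
    (G : topGroupType) (N : closed_normal_subgroup G) :
  residually_class C G ->
  exists J : closed_normal_subgroup G,
    forall x, cns_set J x <-> forall n, cns_set N n -> x * n = n * x.
Proof.
move=> hG; pose S := [set x : G | forall n, cns_set N n -> x * n = n * x].
have S1 : S 1 by move=> n _; rewrite mul1g mulg1.
have SM x y : S x -> S y -> S (x * y).
  by move=> Sx Sy n Nn; rewrite -mulgA (Sy n Nn) [LHS]mulgA (Sx n Nn) -mulgA.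
have SV x : S x -> S x^-1.
  move=> Sx n Nn; apply: (mulgI x); by rewrite mulVKg mulgA (Sx n Nn) mulgK.
have SJ g x : S x -> S (g * x * g^-1).
  move=> Sx n Nn; have := Sx _ (cnsJ g^-1 Nn); rewrite invgK => e.
  have : g * (x * (g^-1 * n * g)) * g^-1 = g * (g^-1 * n * g * x) * g^-1 by rewrite e.
  by rewrite !mulgA mulgK mulgV mul1g.
have Scl : closed S.
  rewrite (_ : S = \bigcap_(n in N) ((fun x => x * n * x^-1 * n^-1) @^-1` [set 1])).
    apply: closed_bigI => n _; have [_ c1 _] := hG; apply: closed_preimage c1.
    have cid := @continuous_idfun G.
    apply: continuous_mul; last exact: cst_continuous.
    apply: continuous_mul; last exact: continuous_inv.
    exact: continuous_rmul.
  apply/seteqP; split=> x Sx n Nn.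
    by rewrite /= (Sx n Nn) mulgK mulgV.
  have /= e := Sx n Nn; apply: (mulIg x^-1); rewrite mulgK.
  by apply: (mulIg n^-1); rewrite e mulgV.
by exists (ClosedNormalSubgroup S1 SM SV SJ Scl).
Qed.

Lemma kernel_saturation (C : finite_group_class) (G : topGroupType) (H : finGroupType)
    (f : G -> H) (N : closed_normal_subgroup G) :
  finite_hom C f ->
  exists M : closed_normal_subgroup G, open (cns_set M) /\
    forall x, cns_set M x <-> exists2 n, cns_set N n & f x = f n.
Proof.
move=> hf; have [fM _ _] := hf.
pose S := [set x : G | exists2 n, cns_set N n & f x = f n].
have S1 : S 1 by exists 1 => //; exact: cns1.
have SM x y : S x -> S y -> S (x * y).
  by move=> [n Nn en] [m Nm em]; exists (n * m); [exact: cnsM|rewrite !fM en em].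
have SV x : S x -> S x^-1.
  by move=> [n Nn en]; exists n^-1; [exact: cnsV|rewrite !(homV fM) en].
have SJ g x : S x -> S (g * x * g^-1).
  by move=> [n Nn en]; exists (g * n * g^-1); [exact: cnsJ|rewrite !fM en].
have SE : S = f @^-1` (f @` N).
  by apply/seteqP; split=> x [n Nn e]; exists n.
have Scl : closed S by rewrite SE; exact: (@finite_hom_closed _ _ _ _ (f @` N) hf).
exists (ClosedNormalSubgroup S1 SM SV SJ Scl); split=> //=.
by rewrite SE; exact: (@finite_hom_open _ _ _ _ (f @` N) hf).
Qed.

Lemma conj_on_aut (G : topGroupType) (N : closed_normal_subgroup G) (g : G) :
  continuous_aut (conj_on (N := N) g).
Proof.
have cc (h : G) : continuous (conj_on (N := N) h).
  apply/continuousP => _ [W oW <-]; exists ((fun x => h * x * h^-1) @^-1` W) => //.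
  apply: open_preimage oW; apply: continuous_mul; last exact: cst_continuous.
  exact: continuous_lmul.
split=> //.
- by move=> x y z /= ->; rewrite !mulgA mulgVK.
- exists (conj_on (N := N) g^-1); split=> // x; apply: val_inj => /=; rewrite invgK.
    by rewrite !mulgA mulVg mul1g mulgVK.
  by rewrite !mulgA mulgV mul1g mulgK.
Qed.

(** [K] is the product of [N] and its centralizer. Two elements with the same outer class differ by
    an element of [K], so the finite set of classes bounds the index of this closed subgroup. *)
Lemma inner_acting_open (C : finite_group_class) (hC : closed_class C)
    (G : topGroupType) (N : closed_normal_subgroup G) :
  residually_class C G -> finite_set (@image_in_Out G N) ->
  exists K : closed_normal_subgroup G,
    [/\ open (cns_set K), cns_set N `<=` K & forall x, cns_set K x ->
      exists2 n, cns_set N n &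
        forall m, cns_set N m -> n^-1 * x * m = m * (n^-1 * x)].
Proof.
move=> hG fin.
have [Z ZP] := closed_normal_centralizer N hG.
have [K KP] := closed_normal_product hC N Z hG.
exists K; split; last first.
- by move=> x /KP[n [c [Nn Zc ->]]]; exists n => // m Nm; rewrite mulKg; exact: (iffLR (ZP c)).
- by move=> n Nn; apply/KP; exists n, 1; rewrite mulg1; split=> //; exact: cns1.
apply: (@finite_index_open _ K _ _ (fun g u => u = outer_class (conj_on (N := N) g)) _ fin).
- by split; [exact: cns1|exact: cnsM|exact: cnsV|exact: cns_closed].
- by move=> g; exists (outer_class (conj_on (N := N) g)) => //; exists g.
move=> g g' _ -> e.
have : outer_class (conj_on (N := N) g) (conj_on (N := N) g).
  split; first exact: conj_on_aut.
  by exists 1; [exact: cns1|move=> x; congr conj_on; apply: val_inj; rewrite /= mul1g invg1 mulg1].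
rewrite e => -[_ [n Nn gn]].
apply/KP; exists n, (n^-1 * (g'^-1 * g)); split=> //; last by rewrite mulVKg.
apply/ZP => m Nm.
have /(congr1 val) /= := gn (exist _ m (mem_set Nm)) => eg.
set u := n^-1 * _.
have gu : g = g' * n * u by rewrite /u -mulgA mulVKg mulVKg.
apply: (mulIg u^-1); rewrite mulgK; apply: (mulgI (g' * n)); apply: (mulIg (g' * n)^-1).
transitivity (g * m * g^-1); first by rewrite gu !invgM !mulgA.
by rewrite eg !invgM !mulgA.
Qed.

(** * Finite generation and torsion *)

Section KernelGenerated.
Variables (C : finite_group_class) (hC : closed_class C).
Variables (X : finite_graph) (A : proC_graph C X) (T : subgraph X).
Variable Pi : fundamental_group A T.
Variables (N : closed_normal_subgroup Pi) (P : finGroupType) (q : Pi -> P).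
Hypotheses (hq : finite_hom C q) (qs : forall b, exists x, q x = b).
Hypothesis qN : forall x, cns_set N x -> q x = 1.
Hypothesis phiN : forall v (g : vgroup A v), q (phi Pi g) = 1 -> cns_set N (phi Pi g).

Let qM : {morph q : x y / x * y} := let: And3 h _ _ := hq in h.
Let phiM v : {morph (@phi _ _ _ _ Pi v) : x y / x * y} :=
  proj1 (phi_continuous_hom Pi v).

(* Schreier's lemma, with the generators [y b * x * (y (b * q x))^-1]. *)
Lemma kernel_generated : exists (J : finType) (h : J -> Pi),
  (forall j, q (h j) = 1) /\
  forall S : set Pi, closed_subgroup S -> cns_set N `<=` S ->
    (forall j, S (h j)) -> forall l, q l = 1 -> S l.
Proof.
have [y [qy y1]] : exists y : P -> Pi, (forall b, q (y b) = b) /\ y 1 = 1.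
  have [y0 qy0] := choice qs.
  exists (fun b => if b == 1 then 1 else y0 b); split; last by rewrite eqxx.
  by move=> b; case: eqVneq => [->|_]; [exact: hom1|exact: qy0].
(* One representative for each coset of [N] in each vertex group, labelled by its image in [P]; the
   value is 1 when [b] is not such an image. With the [fg_t] they generate [Pi] modulo [N]. *)
have /choice[gv gvP] : forall vb : vert X * P, exists x : Pi,
    forall g : vgroup A vb.1, q (phi Pi g) = vb.2 -> exists2 n, cns_set N n & phi Pi g = n * x.
  move=> [v b] /=; have [[g0 gb]|ng] := pselect (exists g : vgroup A v, q (phi Pi g) = b); last first.
    by exists 1 => g gb; case: ng; exists g.
  exists (phi Pi g0) => g qg; exists (phi Pi (g * g0^-1)).
    by apply: phiN; rewrite phiM (homV (@phiM v)) qM (homV qM) qg gb mulgV.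
  by rewrite phiM (homV (@phiM v)) mulgVK.
pose x (i : edge X + vert X * P) : Pi := match i with inl e => fg_t Pi e | inr vb => gv vb end.
exists ((edge X + vert X * P) * P)%type, (fun ib => y ib.2 * x ib.1 * (y (ib.2 * q (x ib.1)))^-1).
split=> [[i b]|S clS NS Sh l ql] /=.
  by rewrite !qM (homV qM) !qy mulgV.
(* Quantifying over all [b] makes the condition multiplicative: the Schreier element of [u * v] at
   [b] is that of [u] at [b] times that of [v] at [b * q u]. *)
pose R := [set z | forall b, S (y b * z * (y (b * q z))^-1)].
have [S1 SM SV cS] := clS.
have R1 : R 1 by move=> b; rewrite (hom1 qM) !mulg1 mulgV.
have RM u v : R u -> R v -> R (u * v).
  move=> Ru Rv b; have := SM _ _ (Ru b) (Rv (b * q u)).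
  by rewrite !mulgA mulgVK qM mulgA.
have RV u : R u -> R u^-1.
  move=> Ru b; have := SV _ (Ru (b * (q u)^-1)).
  by rewrite mulgVK !invgM invgK !mulgA (homV qM).
have cR : closed R.
  rewrite (_ : R = \bigcap_b ((fun z => y b * z * (y (b * q z))^-1) @^-1` S)).
    apply: closed_bigI => b _; apply: closed_preimage cS.
    apply: continuous_mul; first exact: continuous_lmul.
    have [_ cq] := finite_hom_continuous hq.
    exact: (@discrete_continuous_comp _ _ P _ (fun c => (y (b * c))^-1) cq).
  by apply/seteqP; split=> z Rz b; [move=> _|]; exact: Rz.
have RN n : cns_set N n -> R n.
  by move=> Nn b; apply: NS; rewrite qN // mulg1; exact: cnsJ.
have Rx i : R (x i) by move=> b; exact: (Sh (i, b)).
have : R l.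
  apply: (fundamental_generated hC (S := R)) => //.
  - move=> v g; have [n Nn ->] := gvP (v, q (phi Pi g)) g erefl.
    by apply: RM; [exact: RN|exact: (Rx (inr (v, q (phi Pi g))))].
  - move=> e; exact: (Rx (inl e)).
by move=> /(_ 1); rewrite y1 ql mulg1 y1 invg1 mulg1 mul1g.
Qed.

End KernelGenerated.

Lemma closed_finite_set (G : topGroupType) (C : finite_group_class) (A : set G) :
  closed_class C -> residually_class C G -> finite_set A -> closed A.
Proof.
move=> hC hG fA; rewrite (_ : A = \bigcup_(a in A) [set a]).
  by apply: closed_bigcup => // a _; exact: (closed_point hG).
by apply/seteqP; split=> [a Aa|_ [a Aa ->]] //; exists a.
Qed.

Section Commuting.
Variables (G : groupType) (J : finType).

Lemma prod_expD (c : J -> G) (m n : J -> nat) :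
  (forall i j, commute (c i) (c j)) ->
  \prod_j c j ^+ (m j + n j) = (\prod_j c j ^+ m j) * \prod_j c j ^+ n j.
Proof.
move=> cc; rewrite -prodgM_commute.
  by apply: eq_bigr => j _; rewrite expgnDr.
by move=> i j _ _; apply: commuteX2.
Qed.

Lemma prod_expM (c : J -> G) (n : J -> nat) k :
  (forall i j, commute (c i) (c j)) ->
  \prod_j c j ^+ (k * n j) = (\prod_j c j ^+ n j) ^+ k.
Proof.
move=> cc; elim: k => [|k IH]; first by rewrite expg0 big1 // => j _; rewrite mul0n.
by rewrite expgS -IH -prod_expD //; apply: eq_bigr => j _; rewrite mulSn.
Qed.

Lemma prod_exp_mod (c : J -> G) (n : J -> nat) m :
  (forall j, c j ^+ m = 1) -> \prod_j c j ^+ n j = \prod_j c j ^+ (n j %% m).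
Proof.
move=> cm; apply: eq_bigr => j _; rewrite {1}(divn_eq (n j) m) expgnDr mulnC.
by rewrite expgnA cm expg1n mul1g.
Qed.

End Commuting.

(** In a finite abelian group the kernel of the [k]-th power map has as many elements as the
    quotient by its image, and [v] represents all classes of this quotient. *)
Lemma card_torsion (H : finGroupType) (A : {group H}) (k : nat) (I : finType)
    (v : I -> H) :
  abelian A ->
  (forall x, x \in A -> exists b i, b \in A /\ x = b ^+ k * v i) ->
  #|[set x in A | x ^+ k == 1]%SET| <= #|I|.
Proof.
move=> abA dec.
have pM : {in A &, {morph (fun x => x ^+ k) : x y / x * y}}.
  by move=> x y xA yA; apply: expgMn; apply: (centsP abA).
pose f := Morphism pM.
have kf : [set x in A | x ^+ k == 1]%SET = 'ker f.
  apply/setP => x; rewrite finset.inE; apply/andP/idP => [[xA /eqP e]|kx].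
    exact/kerP.
  by split; [exact: dom_ker kx|apply/eqP; exact: (mker kx)].
rewrite kf -(leq_pmul2l (cardG_gt0 (f @* A))).
have -> : (#|f @* A| * #|'ker f|)%N = #|A|.
  by rewrite card_morphim finset.setIid mulnC Lagrange // finset.subsetIl.
rewrite -cardsT -cardsX.
apply: leq_trans (leq_imset_card (fun p : H * I => p.1 * v p.2) _).
apply: subset_leq_card; apply/fintype.subsetP => x /dec[b [i [bA ->]]].
apply/imsetP; exists (b ^+ k, i) => //; rewrite finset.in_setX finset.in_setT andbT.
exact: (mem_morphim f bA bA).
Qed.

Lemma separate_seq (C : finite_group_class) (hC : closed_class C) (G : topGroupType)
    (s : seq G) :
  residually_class C G ->
  exists (H : finGroupType) (f : G -> H), finite_hom C f /\ {in s &, injective f}.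
Proof.
move=> hG; elim: s => [|x s [H [f [hf fI]]]].
  have [_ _ /(_ setT openT I)[H [f [hf _]]]] := hG.
  by exists H, f; split=> // a b; rewrite in_nil.
have [|||K [g [hg gx]]] := @separate_sets C hC G hG [set x] ([set` s] `\ x).
- exact: (closed_point hG).
- apply: (closed_finite_set hC hG); apply: finite_setD; exact: finite_seq.
- by apply/seteqP; split=> // z [-> [_ nx]]; exact: (nx erefl).
exists (H * K)%type, (fun z => (f z, g z)); split; first exact: finite_hom_pair.
move=> a b; rewrite !inE => /predU1P[->|sa] /predU1P[->|sb] // [ef eg].
- by apply: contrapT => ne; apply: (gx x b erefl _ eg); split=> // /esym.
- by apply: contrapT => ne; apply: (gx x a erefl _ (esym eg)).
- exact: fI.
Qed.

Section FinitelyGenerated.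
Variables (Pi : topGroupType) (N L : set Pi) (J : finType) (h : J -> Pi).
Hypothesis clL : closed_subgroup L.
Hypothesis NL : N `<=` L.
Hypothesis hL : forall j, L (h j).
Hypothesis genL : forall S : set Pi, closed_subgroup S -> N `<=` S ->
    (forall j, S (h j)) -> forall l, L l -> S l.

(** The products with exponents below [m] form a finite, hence closed, subgroup that contains the
    images of the generators. Multiplicativity of [w] is asked on [L] only, which is all that
    [omega] provides. *)
Lemma abelian_image_products (R : topGroupType) (w : Pi -> R) (m : nat) :
  0 < m -> (forall x : R, closed [set x]) -> continuous w ->
  (forall l l', L l -> L l' -> w (l * l') = w l * w l') ->
  (forall n, N n -> w n = 1) ->
  (forall l l', L l -> L l' -> commute (w l) (w l')) ->
  (forall j, w (h j) ^+ m = 1) ->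
  forall l, L l -> exists n : {ffun J -> 'I_m}, w l = \prod_j w (h j) ^+ n j.
Proof.
move=> m0 cR cw wM wN wC wm.
pose E := [set x : R | exists n : {ffun J -> 'I_m}, x = \prod_j w (h j) ^+ n j].
have cc i j : commute (w (h i)) (w (h j)) by exact: wC.
have EP x : E x <-> exists n : J -> nat, x = \prod_j w (h j) ^+ n j.
  split=> [[n ->]|[n ->]]; first by exists (fun j => n j : nat).
  rewrite (prod_exp_mod _ wm).
  exists [ffun j => Ordinal (ltn_pmod (n j) m0)].
  by apply: eq_bigr => j _; rewrite ffunE.
have E1 : E 1 by apply/EP; exists (fun=> 0); rewrite big1 // => j _; rewrite expg0.
have EM x y : E x -> E y -> E (x * y).
  move=> /EP[n ->] /EP[k ->]; apply/EP; exists (fun j => n j + k j).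
  by rewrite prod_expD.
have Em x : E x -> x ^+ m = 1.
  move=> /EP[n ->]; rewrite -prod_expM // big1 // => j _.
  by rewrite expgnA wm expg1n.
have EX x k : E x -> E (x ^+ k).
  by move=> Ex; elim: k => [|k IH]; rewrite ?expg0 // expgS; exact: EM.
have EV x : E x -> E x^-1.
  move=> Ex; have -> : x^-1 = x ^+ m.-1.
    by apply: (mulgI x); rewrite mulgV -expgS prednK // Em.
  exact: EX.
have cE : closed E.
  rewrite (_ : E = \bigcup_(n : {ffun J -> 'I_m}) [set \prod_j w (h j) ^+ n j]).
    apply: closed_bigcup => //; exact: finite_finset.
  by apply/seteqP; split=> [x [n ->]|x [n _ ->]]; exists n.
have [L1 LM LV cL] := clL.
have w1 : w 1 = 1 by apply: (@mulgI _ (w 1)); rewrite -wM // !mulg1.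
move=> l Ll; suff [] : (L `&` w @^-1` E) l by [].
apply: genL => //.
- split.
  + by split=> //; rewrite /= w1.
  + by move=> a b [La Ea] [Lb Eb]; split; [exact: LM|rewrite /= wM //; exact: EM].
  + move=> a [La Ea]; split; first exact: LV.
    rewrite /= (_ : w a^-1 = (w a)^-1); first exact: EV.
    by apply: (mulIg (w a)); rewrite -wM ?mulVg //; exact: LV.
  + by apply: closedI => //; exact: closed_preimage cw cE.
- by move=> n Nn; split; [exact: NL|rewrite /= wN].
- move=> j; split=> //; rewrite /=; apply/EP; exists (fun i => i == j : nat).
  rewrite (eq_bigr (fun i => if i == j then w (h j) else 1)).
    by rewrite -big_mkcond big_pred1_eq.
  by move=> i _; case: eqVneq => [->|_]; rewrite ?expg1 ?expg0.
Qed.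

(** The bound is the number of functions from [J] to residues modulo [k]. More torsion elements than
    that would stay distinct in some finite quotient, whose image of [L] is abelian and generated by
    the [h j]; reducing exponents modulo [k] leaves at most that many classes modulo [k]-th powers,
    against [card_torsion]. *)
Lemma torsion_finite (C : finite_group_class) (R : topGroupType) (w : Pi -> R) (k : nat) :
  closed_class C -> residually_class C R ->
  0 < k -> continuous w ->
  (forall l l', L l -> L l' -> w (l * l') = w l * w l') ->
  (forall n, N n -> w n = 1) ->
  (forall l l', L l -> L l' -> commute (w l) (w l')) ->
  finite_set [set w l | l in [set l | L l /\ w l ^+ k = 1]].
Proof.
move=> hC hR k0 cw wM wN wC; apply: contrapT => /infinite_set_fset.
move=> /(_ #|{ffun J -> 'I_k}|.+1)[B BT cB].
have [H [f [hf fI]]] := separate_seq hC (finmap.enum_fset B) hR.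
have [L1 LM LV _] := clL; have [fM _ _] := hf.
have fw1 : f (w 1) = 1 by apply: (@mulgI _ (f (w 1))); rewrite -fM -wM // !mulg1.
have gA : group_set [set x : H | `[<exists2 l, L l & f (w l) = x>]]%SET.
  apply/group_setP; split.
    by rewrite finset.inE; apply/asboolP; exists 1.
  move=> a b; rewrite !finset.inE => /asboolP[l Ll <-] /asboolP[m Lm <-].
  by apply/asboolP; exists (l * m); [exact: LM|rewrite wM // fM].
pose A := Group gA.
have AP x : x \in A <-> exists2 l, L l & f (w l) = x.
  by rewrite finset.inE; split=> /asboolP.
have abA : abelian A.
  apply/centsP => x /AP[l Ll <-] z /AP[m Lm <-].
  by rewrite /commute -!fM wC.
have [_ cf] := finite_hom_continuous hf.
have prods : forall l, L l -> exists n : {ffun J -> 'I_#|[set: H]%SET|},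
    f (w l) = \prod_j f (w (h j)) ^+ n j.
  apply: (@abelian_image_products (discrete_group H) (f \o w)).
  - exact: (cardG_gt0 [set: H]%G).
  - move=> x; rewrite -[X in closed X]setCK closedC; exact: discrete_group_open.
  - by move=> x; apply: continuous_comp; [exact: cw|exact: cf].
  - by move=> l m Ll Lm; rewrite /= wM.
  - by move=> n Nn; rewrite /= wN // (hom1 fM).
  - by move=> l m Ll Lm; rewrite /commute /= -!fM wC.
  - by move=> j; exact: (expg_cardG (finset.in_setT (f (w (h j))))).
have cc i j : commute (f (w (h i))) (f (w (h j))) by rewrite /commute -!fM wC.
have prodA (n : J -> nat) : \prod_j f (w (h j)) ^+ n j \in A.
  by apply: group_prod => j _; rewrite groupX //; apply/AP; exists (h j).
have dec x : x \in A -> exists b (v : {ffun J -> 'I_k}),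
    b \in A /\ x = b ^+ k * \prod_j f (w (h j)) ^+ v j.
  move=> /AP[l Ll <-].
  have [n ->] := prods l Ll.
  exists (\prod_j f (w (h j)) ^+ (n j %/ k)), [ffun j => Ordinal (ltn_pmod (n j) k0)].
  split; first exact: (prodA (fun j => n j %/ k)).
  rewrite -prod_expM // [X in _ * X](eq_bigr (fun j => f (w (h j)) ^+ (n j %% k))).
    rewrite -prod_expD //; apply: eq_bigr => j _; congr (_ ^+ _).
    by rewrite mulnC -divn_eq.
  by move=> j _; rewrite ffunE.
have := card_torsion abA dec; apply/negP; rewrite -ltnNge; apply: leq_trans cB _.
have us : uniq [seq f x | x <- finmap.enum_fset B].
  by rewrite map_inj_in_uniq //; exact: finmap.fset_uniq.
rewrite -(size_map f) -(card_uniqP us); apply: subset_leq_card.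
apply/fintype.subsetP => _ /mapP[x xB ->].
have [l [Ll lk] <-] := BT x xB; rewrite finset.inE; apply/andP; split.
  by apply/AP; exists l.
by apply/eqP; rewrite -(homX fM) lk (hom1 fM).
Qed.

End FinitelyGenerated.

(** * The averaged complement *)

Lemma continuous_bigprod (X : topologicalType) (G : topGroupType) (I : Type)
    (r : seq I) (F : I -> X -> G) :
  (forall i, continuous (F i)) -> continuous (fun x => \prod_(i <- r) F i x).
Proof.
move=> cF; elim: r => [|i r IH].
  have -> : (fun x => \prod_(i <- [::]) F i x) = fun _ => 1.
    by apply/funext => x; rewrite big_nil.
  exact: cst_continuous.
have -> : (fun x => \prod_(j <- i :: r) F j x) = fun x => F i x * \prod_(j <- r) F j x.
  by apply/funext => x; rewrite big_cons.
exact: continuous_mul.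
Qed.

Lemma hom_bigprod (G H : groupType) (f : G -> H) (I : finType) (F : I -> G) :
  {morph f : x y / x * y} -> f (\prod_i F i) = \prod_i f (F i).
Proof. by move=> fM; apply: big_morph => //; exact: hom1. Qed.

Lemma prod_perm_commute (G : groupType) (I : eqType) (F : I -> G) (s t : seq I) :
  (forall i j, commute (F i) (F j)) -> perm_eq s t ->
  \prod_(i <- s) F i = \prod_(i <- t) F i.
Proof.
move=> cF; elim: s t => [|x s IH] t.
  by rewrite perm_sym => /perm_nilP ->.
move=> st; have xt : x \in t by rewrite -(perm_mem st) mem_head.
case/splitPr: xt st => t1 t2 st0.
have st : perm_eq s (t1 ++ t2).
  rewrite -(perm_cons x); apply: perm_trans st0 _.
  by rewrite -[x :: t2]cat1s perm_catCA.
rewrite big_cons (IH _ st) !big_cat big_cons /= !mulgA; congr (_ * _).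
by apply: commute_prod => i _; exact: cF.
Qed.

Lemma prod_reindex_commute (G : groupType) (I : finType) (F : I -> G) (h : I -> I) :
  injective h -> (forall i j, commute (F i) (F j)) ->
  \prod_i F i = \prod_i F (h i).
Proof.
move=> hI cF; rewrite -(big_map h predT F); apply: prod_perm_commute => //.
apply: uniq_perm; rewrite ?index_enum_uniq ?(map_inj_uniq hI) ?index_enum_uniq //.
move=> i; rewrite mem_index_enum; apply/esym/mapP.
by have [g gK hK] := injF_bij hI; exists (g i); rewrite ?mem_index_enum ?hK.
Qed.

Section Complement.
Variables (C : finite_group_class) (hC : closed_class C).
Variables (G : topGroupType) (hG : residually_class C G).
Variables (N D : closed_normal_subgroup G) (P : finGroupType) (q : G -> P).
Hypotheses (hq : finite_hom C q) (qs : forall b, exists x, q x = b).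
Hypothesis ND : forall n d, cns_set N n -> cns_set D d -> commute n d.
Hypothesis qN : forall x, cns_set N x -> q x = 1.
Hypothesis qD : forall x, cns_set D x -> q x = 1.
Hypothesis kerND : forall x, q x = 1 ->
  exists n d, [/\ cns_set N n, cns_set D d & x = n * d].
Variable s : P -> G -> G.
Hypothesis s_continuous : forall b, continuous (s b).
Hypothesis sM : forall b x x', s b (x * x') = s (q x' * b) x * s b x'.
Hypothesis sN1 : forall b n, cns_set N n -> s b n = 1.
Hypothesis sN : forall b x, cns_set N (s b x * x^-1).
Hypothesis sD : forall b x, q x = 1 -> cns_set D (s b x).
Variables (J : finType) (h : J -> G).
Hypothesis qh : forall j, q (h j) = 1.
Hypothesis gen : forall S : set G, closed_subgroup S -> cns_set N `<=` S ->
    (forall j, S (h j)) -> forall l, q l = 1 -> S l.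

Let qM : {morph q : x y / x * y} := let: And3 h _ _ := hq in h.
Let k := #|P|.
Let L := [set l : G | q l = 1].
Let Z := [set z : G | cns_set N z /\ cns_set D z].

Let LM x y : L x -> L y -> L (x * y).
Proof. by move=> Lx Ly; rewrite /L /= qM Lx Ly mulg1. Qed.
Let LV x : L x -> L x^-1.
Proof. by move=> Lx; rewrite /L /= (homV qM) Lx invg1. Qed.
Let LJ g x : L x -> L (g * x * g^-1).
Proof. by move=> Lx; rewrite /L /= !qM (homV qM) Lx mulg1 mulgV. Qed.
Let Z1 : Z 1. Proof. by split; exact: cns1. Qed.
Let ZM x y : Z x -> Z y -> Z (x * y).
Proof. by move=> [? ?] [? ?]; split; exact: cnsM. Qed.

Let ZL z : Z z -> L z. Proof. by move=> [Nz _]; exact: qN. Qed.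

Let ZC z l : Z z -> L l -> commute z l.
Proof.
move=> [Nz Dz] /kerND[n [d [Nn Dd ->]]]; apply: commuteM.
  by apply: commute_sym; exact: ND.
exact: ND.
Qed.

Let sL b x x' : L x' -> s b (x * x') = s b x * s b x'.
Proof. by move=> Lx; rewrite sM Lx mul1g. Qed.

Let s1 b : s b 1 = 1. Proof. exact/sN1/cns1. Qed.

(** The cocycle rule turns the left side into the conjugate of [s b l] by [s b g]. The latter is [g]
    up to a left factor in [N], which commutes with the conjugate of [s b l] in [D]. *)
Let sJ b g l : L l -> s (q g * b) (g * l * g^-1) = g * s b l * g^-1.
Proof.
move=> Ll; have e : s (q g * b) g^-1 = (s b g)^-1.
  apply: (mulgI (s b g)); rewrite mulgV.
  by have := sM (q g * b) g g^-1; rewrite mulgV s1 (homV qM) mulKg => <-.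
rewrite sM (homV qM) mulKg sL // e.
have := sN b g; set n := _ * g^-1 => Nn.
have sg : s b g = n * g by rewrite /n mulgVK.
have Dl := cnsJ g (sD b Ll).
rewrite sg invgM !mulgA -(mulgA n) -(mulgA n) (ND Nn Dl : n * _ = _ * n).
by rewrite mulgK.
Qed.

Let delta (c b : P) (l : G) : G := s c l * (s b l)^-1.

Let Zdelta c b l : L l -> Z (delta c b l).
Proof.
move=> Ll; split; last by apply: cnsM; [exact: sD|apply: cnsV; exact: sD].
have := cnsM (sN c l) (cnsV (sN b l)).
by rewrite invgM invgK !mulgA mulgVK.
Qed.

Let LsL b l : L l -> L (s b l). Proof. by move=> /(sD b); exact: qD. Qed.

Let deltaM c b l l' : L l -> L l' -> delta c b (l * l') = delta c b l * delta c b l'.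
Proof.
move=> Ll Ll'; rewrite /delta !sL // invgM.
have e := ZC (Zdelta c b Ll') (LV (LsL b Ll)).
rewrite -[in RHS]mulgA -[X in _ = _ * X]e /delta.
by rewrite !mulgA.
Qed.

Let deltaT a c b l : delta a b l = delta a c l * delta c b l.
Proof. by rewrite /delta mulgA mulgVK. Qed.

(** In additive terms, [k] times the difference between the mean of the splittings and [s b]. *)
Let omega (b : P) (l : G) : G := \prod_c delta c b l.

Let Zomega b l : L l -> Z (omega b l).
Proof. by move=> Ll; apply: big_ind => // c _; exact: Zdelta. Qed.

Let omegaM b l l' : L l -> L l' -> omega b (l * l') = omega b l * omega b l'.
Proof.
move=> Ll Ll'; rewrite /omega -prodgM_commute.
  by apply: eq_bigr => c _; exact: deltaM.
by move=> i j _ _; apply: ZC; [exact: Zdelta|apply: ZL; exact: Zdelta].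
Qed.

Let omega_continuous b : continuous (omega b).
Proof.
apply: continuous_bigprod => c; apply: continuous_mul; first exact: s_continuous.
by apply: continuous_inv; exact: s_continuous.
Qed.

Let omega_N b n : cns_set N n -> omega b n = 1.
Proof.
by move=> Nn; rewrite /omega big1 // => c _; rewrite /delta !sN1 // mulgV.
Qed.

Let omega_shift c b l : L l -> omega b l = omega c l * delta c b l ^+ k.
Proof.
move=> Ll; rewrite /omega /k -prodg_const -prodgM_commute.
  by apply: eq_bigr => a _; exact: deltaT.
by move=> i j _ _; apply: ZC; [exact: Zdelta|apply: ZL; exact: Zdelta].
Qed.

Let deltaJ g c b l : L l ->
  delta (q g * c) (q g * b) (g * l * g^-1) = g * delta c b l * g^-1.
Proof.
move=> Ll; rewrite /delta !sJ // !invgM invgK !mulgA mulgVK.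
by [].
Qed.

Let omegaJ g b l : L l -> omega (q g * b) (g * l * g^-1) = g * omega b l * g^-1.
Proof.
move=> Ll; rewrite /omega (@prod_reindex_commute _ _ _ (fun c => q g * c)).
- rewrite (hom_bigprod (f := fun x => g * x * g^-1)).
    by apply: eq_bigr => c _; exact: deltaJ.
  by move=> x y; rewrite !mulgA mulgVK.
- exact: mulgI.
- by move=> i j; apply: ZC; [apply: Zdelta|apply: ZL; apply: Zdelta]; exact: LJ.
Qed.

(* [rho b] restricts to a retraction of [D] onto the central subgroup [Z]. *)
Let rho (b : P) (w : G) : G := w * (s b w)^-1.

Let rhoE b w : cns_set D w -> Z (rho b w).
Proof.
move=> Dw; split; last by apply: cnsM => //; apply: cnsV; apply: sD; exact: qD.
by have := cnsV (sN b w); rewrite invgM invgK.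
Qed.

Let rhoM b w w' : cns_set D w -> cns_set D w' -> rho b (w * w') = rho b w * rho b w'.
Proof.
move=> Dw Dw'; have Lw := qD Dw; have Lw' := qD Dw'.
rewrite /rho sL // invgM.
have e := ZC (rhoE b Dw') (LV (LsL b Lw)).
rewrite -[in RHS]mulgA -[X in _ = _ * X]e /rho.
by rewrite !mulgA.
Qed.

Let rho_Z b z : Z z -> rho b z = z.
Proof. by move=> [Nz _]; rewrite /rho sN1 // invg1 mulg1. Qed.

Let rhoJ g b w : cns_set D w -> rho (q g * b) (g * w * g^-1) = g * rho b w * g^-1.
Proof.
move=> Dw; rewrite /rho sJ //; last exact: qD.
by rewrite !invgM invgK !mulgA mulgVK.
Qed.

(** [s c l] and [l] differ by a left factor in [N], which [s b] kills, so [s b (s c l)] is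
    [s b l]. *)
Let rho_s b c l : L l -> rho b (s c l) = delta c b l.
Proof.
move=> Ll; rewrite /rho /delta; congr (_ * _^-1).
by rewrite -{1}[s c l](mulgVK l) sL // sN1 ?mul1g.
Qed.

(* For [l] in [L] the element [s 1 l ^+ k * omega 1 l] belongs to [W] and is
   congruent to [l ^+ k] modulo [N]; unlike [s 1 l ^+ k], it does not depend on
   the chosen splitting [s 1] modulo commutators, so that [W] is normal. *)
Lemma averaged_complement : exists W : closed_normal_subgroup G,
  forall w, cns_set W w <->
    cns_set D w /\ exists2 l, L l & forall b, rho b w = omega b l.
Proof.
pose S := [set w | cns_set D w /\ exists2 l, L l & forall b, rho b w = omega b l].
have S1 : S 1.
  split; first exact: cns1.
  exists 1; first exact: hom1.
  by move=> b; rewrite rho_Z // omega_N //; exact: cns1.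
have SM x y : S x -> S y -> S (x * y).
  move=> [Dx [l Ll xl]] [Dy [m Lm ym]]; split; first exact: cnsM.
  by exists (l * m); [exact: LM|move=> b; rewrite rhoM // omegaM // xl ym].
have SV x : S x -> S x^-1.
  move=> [Dx [l Ll xl]]; have DVx := cnsV Dx; split => //.
  exists l^-1; first exact: LV.
  move=> b; apply: (mulIg (rho b x)); rewrite -rhoM // mulVg rho_Z // xl.
  by rewrite -omegaM ?mulVg ?omega_N //; [exact: cns1|exact: LV].
have SJ g x : S x -> S (g * x * g^-1).
  move=> [Dx [l Ll xl]]; split; first exact: cnsJ.
  exists (g * l * g^-1); first exact: LJ.
  by move=> b; rewrite -[b](mulVKg (q g)) rhoJ // omegaJ // xl.
have [cG c1 _] := hG.
have cfst : continuous (fun p : G * G => p.1) by move=> p; exact: cvg_fst.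
have csnd : continuous (fun p : G * G => p.2) by move=> p; exact: cvg_snd.
have cc (Y : topologicalType) (f : G * G -> G) (g : G -> Y) :
    continuous f -> continuous g -> continuous (fun x => g (f x)).
  by move=> cf cg x; apply: continuous_comp; [exact: cf|exact: cg].
have Scl : closed S.
  (* The witness [l] ranges over a compact set, so the set is the projection of a compact set of
     pairs and therefore closed. *)
  pose E := (fun p : G * G => p.1) @^-1` D `&` ((fun p : G * G => p.2) @^-1` L `&`
    \bigcap_b ((fun p : G * G => (rho b p.1)^-1 * omega b p.2) @^-1` [set 1])).
  have -> : S = (fun p : G * G => p.1) @` E.
    apply/seteqP; split=> [w [Dw [l Ll wl]]|_ [[w l] [/= Dw [Ll wl]] <-]].
      by exists (w, l) => //; split=> //; split=> // b _ /=; rewrite wl mulVg.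
    split=> //; exists l => // b; have /= e := wl b I.
    by rewrite -[RHS](mulVKg (rho b w)) e mulg1.
  apply: (closed_image hC hG) => //.
  apply: (@subclosed_compact _ _ [set: G * G]) => //; last first.
    by rewrite -setXTT; exact: compact_setX.
  apply: closedI; first by apply: closed_preimage cfst _; exact: cns_closed.
  apply: closedI.
    by apply: closed_preimage csnd _; exact: (@finite_hom_closed _ _ _ _ [set 1] hq).
  apply: closed_bigI => b _; apply: closed_preimage c1.
  apply: continuous_mul; last exact: cc csnd (@omega_continuous b).
  apply: continuous_inv; apply: continuous_mul => //.
  by apply: continuous_inv; exact: cc cfst (@s_continuous b).
by exists (ClosedNormalSubgroup S1 SM SV SJ Scl).
Qed.

Lemma exists_complement : exists D' M : closed_normal_subgroup G,
  [/\ forall x, cns_set D' x -> q x = 1,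
      forall x, cns_set D' x -> cns_set N x -> x = 1,
      open (cns_set M)
    & forall x, cns_set M x <-> exists n d, [/\ cns_set N n, cns_set D' d & x = n * d]].
Proof.
have k0 : 0 < k by rewrite /k -cardsT; exact: (cardG_gt0 [set: P]%G).
have [W WP] := averaged_complement.
have [J0 J0P] := closed_normal_product hC N W hG.
have clL : closed_subgroup L.
  split=> //; [exact: hom1|exact: (@finite_hom_closed _ _ _ _ [set 1] hq)].
have NL : cns_set N `<=` L by move=> n; exact: qN.
(* [N W] contains the commutators and the [k]-th powers of [L], and [L] is
   finitely generated modulo [N]; hence [N W] has finite index. *)
have powL l : L l -> cns_set J0 (l ^+ k).
  move=> Ll; apply/J0P; pose w := s 1 l ^+ k * omega 1 l.
  have Ds : cns_set D (s 1 l) := sD 1 Ll.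
  have DX n : cns_set D (s 1 l ^+ n).
    by elim: n => [|n IH]; rewrite ?expg0 ?expgS; [exact: cns1|exact: cnsM].
  have Zo := Zomega 1 Ll.
  exists (l ^+ k * w^-1), w; split; last by rewrite mulgVK.
    have NX n : cns_set N (l ^+ n * (s 1 l ^+ n)^-1).
      elim: n => [|n IH]; first by rewrite !expg0 mulgV; exact: cns1.
      rewrite (_ : _ * _ = l * (l ^+ n * (s 1 l ^+ n)^-1) * l^-1 * (s 1 l * l^-1)^-1).
        by apply: cnsM; [exact: cnsJ|apply: cnsV].
      by rewrite !expgS !invgM invgK !mulgA mulgVK.
    have := cnsM (NX k) (cnsJ (s 1 l ^+ k) (cnsV Zo.1)).
    rewrite /w invgM !mulgA mulgVK -[_ * _ * (s 1 l ^+ k)^-1]mulgA.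
    by have [] := Zo.
  apply/WP; split; first by apply: cnsM => //; exact: Zo.2.
  exists l => // b; rewrite rhoM //; last exact: Zo.2.
  rewrite (rho_Z _ Zo) (omega_shift 1 b Ll).
  have -> : rho b (s 1 l ^+ k) = delta 1 b l ^+ k.
    elim: (k) => [|n IH]; first by rewrite !expg0 rho_Z.
    by rewrite !expgS rhoM // IH rho_s.
  apply: commute_sym; apply: commuteX; apply: ZC => //; apply: ZL; exact: Zdelta.
have [R [p hp]] := quotient_exists J0.
have hR := quotient_residually hC hG (@cns_closed _ J0) hp.
have [[pM pc] ps pK _] := hp.
have ps1 l : L l -> p l = p (s 1 l).
  move=> Ll; apply/esym/(hom_eq pM)/pK/J0P.
  exists ((s 1 l)^-1 * l), 1; split; [|exact: cns1|by rewrite mulg1].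
  have := cnsJ (s 1 l)^-1 (cnsV (sN 1 l)).
  by rewrite invgM invgK invgK mulgA mulgVK.
(* Modulo [N] each element of [L] is represented by its image under [s 1], which lies in [D]. Every
   [rho b] has central values, so it kills commutators of [D]; these belong to [W] with witness
   1. *)
have pC l l' : L l -> L l' -> commute (p l) (p l').
  move=> Ll Ll'; rewrite (ps1 l Ll) (ps1 l' Ll') /commute -!pM.
  have Dl := sD 1 Ll; have Dl' := sD 1 Ll'.
  apply/(hom_eq pM)/pK/J0P; set w := _^-1 * _; exists 1, w.
  split; [exact: cns1| |by rewrite mul1g].
  have Dll := cnsM Dl Dl'; have Dll' := cnsM Dl' Dl.
  have Dw : cns_set D w by apply: cnsM => //; exact: cnsV.
  apply/WP; split=> //; exists 1; first exact: hom1.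
  move=> b; rewrite omega_N; last exact: cns1.
  apply: (mulgI (rho b (s 1 l * s 1 l'))); rewrite -rhoM // mulVKg mulg1 !rhoM //.
  by apply: ZC; [exact: rhoE|apply: ZL; exact: rhoE].
have pN n : cns_set N n -> p n = 1.
  by move=> Nn; apply/pK/J0P; exists n, 1; rewrite mulg1; split=> //; exact: cns1.
have prods : forall l, L l -> exists n : {ffun J -> 'I_k}, p l = \prod_j p (h j) ^+ n j.
  apply: (abelian_image_products clL NL qh gen k0 (closed_point hR) pc) => //.
  by move=> j; rewrite -(homX pM); apply/pK/powL.
have finT := torsion_finite clL NL qh gen hC hG k0 (@omega_continuous 1)
  (@omegaM 1) (@omega_N 1)
  (fun l l' Ll Ll' => ZC (Zomega 1 Ll) (ZL (Zomega 1 Ll'))).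
set T := [set omega 1 l | l in _] in finT.
have [|||H [f [hf fT]]] := @separate_sets C hC G hG [set 1] (T `\ 1).
- exact: (closed_point hG).
- by apply: (closed_finite_set hC hG); exact: finite_setD.
- by apply/seteqP; split=> // z [-> [_ nx]]; exact: (nx erefl).
have [fM _ fC] := hf.
have [K KE] := hom_kernel_closed_normal (discrete_group_residually hC fC) (finite_hom_continuous hf).
have [D' D'E] := closed_normal_intersection W K.
have D'P x : cns_set D' x <-> cns_set W x /\ f x = 1 by rewrite D'E KE.
have [M MP] := closed_normal_product hC N D' hG.
exists D', M; split=> //.
- by move=> x /D'P[/WP[Dx _] _]; exact: qD.
- move=> x /D'P[/WP[Dx [l Ll xl]] fx] Nx.
  (* Each [rho b] fixes [x], so the values [omega b l] are the same for all [b]. By [omega_shift]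
     every [delta 1 b l] is then [k]-torsion, hence so is [x], and [x] belongs to the finite set
     [T]. *)
  have xE b : x = omega b l by rewrite -xl rho_Z.
  have d1 b : delta 1 b l ^+ k = 1.
    by apply: (mulgI (omega 1 l)); rewrite -omega_shift // mulg1 -!xE.
  have omX n : omega 1 (l ^+ n) = omega 1 l ^+ n.
    elim: n => [|n IH]; first by rewrite !expg0 omega_N //; exact: cns1.
    rewrite !expgS omegaM ?IH //; elim: n {IH} => [|n IH]; first exact: hom1.
    by rewrite expgS; exact: LM.
  have xk : omega 1 l ^+ k = 1.
    rewrite -omX /omega big1 // => c _.
    have dX n : delta c 1 (l ^+ n) = delta c 1 l ^+ n.
      elim: n => [|n IH]; first by rewrite !expg0 /delta !s1 mulgV.
      rewrite !expgS deltaM ?IH //; elim: n {IH} => [|n IH]; first exact: hom1.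
      by rewrite expgS; exact: LM.
    rewrite dX (_ : delta c 1 l = (delta 1 c l)^-1) ?expVgn ?d1 ?invg1 //.
    by rewrite /delta invgM invgK.
  apply: contrapT => x1; apply: (fT 1 x erefl); last by rewrite fx (hom1 fM).
  by split=> //; exists l.
have [y qy] := choice qs.
(* A label records the class of [g] in [P], the exponents that reduce the rest to an element [n * w]
   of [N] times [W], and the value [f w], which fixes [w] modulo [D']. *)
pose U := (P * {ffun J -> 'I_k} * H)%type.
apply: (@finite_index_open _ M U setT (fun g u => q g = u.1.1 /\
  exists n w, [/\ cns_set N n, cns_set W w, f w = u.2 &
    (y u.1.1 * \prod_j h j ^+ u.1.2 j)^-1 * g = n * w])).
- by split; [exact: cns1|exact: cnsM|exact: cnsV|exact: cns_closed].
- exact: finite_finset.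
- move=> g; have Lg : L ((y (q g))^-1 * g) by rewrite /L /= qM (homV qM) qy mulVg.
  have [n pn] := prods _ Lg.
  have /pK/J0P[m [w [Nm Ww e]]] : p ((\prod_j h j ^+ n j)^-1 * ((y (q g))^-1 * g)) = 1.
    apply/(hom_eq pM); rewrite pn (hom_bigprod _ pM).
    by apply: eq_bigr => j _; rewrite (homX pM).
  exists (q g, n, f w) => //; split=> //; exists m, w; split=> //=.
  by rewrite invgM -mulgA.
move=> g g' [[b n] x] /= [_ [m [w [Nm Ww fw e]]]] [_ [m' [w' [Nm' Ww' fw' e']]]].
have -> : g'^-1 * g = (m' * w')^-1 * (m * w) by rewrite -e -e' invgM invgK -mulgA mulVKg.
apply/MP; exists (w'^-1 * (m'^-1 * m) * w'), (w'^-1 * w); split.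
- by have := cnsJ w'^-1 (cnsM (cnsV Nm') Nm); rewrite invgK.
- apply/D'P; split; first by apply: cnsM => //; exact: cnsV.
  by rewrite fM (homV fM) fw fw' mulVg.
- by rewrite invgM !mulgA mulgK.
Qed.

End Complement.

(** * From tameness to a homomorphism with open injective restrictions *)

Lemma tame_embedding (C : finite_group_class) (hC : closed_class C)
    (X : finite_graph) (A : proC_graph C X) (hA : commensurating A)
    (T : subgraph X) (hT : maximal_subtree T) (Pi : fundamental_group A T) :
  tame Pi ->
  exists (Q : topGroupType) (psi : Pi -> Q),
    [/\ pro_class C Q,
        continuous_hom psi
      & forall v : vert X,
          injective (fun g : vgroup A v => psi (phi Pi g)) /\
          open (range (fun g : vgroup A v => psi (phi Pi g)))].
Proof.
move=> [phiI [N [Nv _ fin]]].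
have hPi := fundamental_residually hC Pi.
have phiM v : {morph (@phi _ _ _ _ Pi v) : x y / x * y}.
  exact: (proj1 (phi_continuous_hom Pi v)).
have [[/set0Pn[r _] _] _] := hA.
(* [N] is open in each of the finitely many compact vertex groups, so their elements outside [N]
   form a closed set. Separating it from [N] ensures that [M], the product of [N] and the kernel of
   [f], contains no further element of a vertex group. *)
pose S := \bigcup_v (phi Pi (v := v) @` ~` (phi Pi (v := v) @^-1` N)).
have [|||H [f [hf fS]]] := @separate_sets C hC Pi hPi S N.
- apply: closed_bigcup => [|v _]; first exact: finite_finset.
  apply: (closed_image hC hPi); first exact: (proj2 (phi_continuous_hom Pi v)).
  have [cG _ _] := pro_class_residually hC (vgroup_proC A v).
  apply: (subclosed_compact _ cG) => //; apply: open_closedC.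
  by case: (Nv v).
- exact: cns_closed.
- by apply/seteqP; split=> // x [[v _ [g nNg <-]] Ng]; exact: nNg.
have [M [oM MP]] := kernel_saturation N hf.
have [K [oK NK KP]] := inner_acting_open hC hPi fin.
have [L LE] := closed_normal_intersection M K.
have oL : open (cns_set L) by rewrite LE; exact: openI.
have NL x : cns_set N x -> cns_set L x.
  by move=> Nx; rewrite LE; split; [apply/MP; exists x|exact: NK].
have [Z ZP] := closed_normal_centralizer N hPi.
have [D DE] := closed_normal_intersection Z L.
have [P [q [hq qs qL]]] := open_normal_quotient hC hPi oL (cns_normal L).
have qN x : cns_set N x -> q x = 1 by move=> /NL /qL.
have phiN v (g : vgroup A v) : q (phi Pi g) = 1 -> cns_set N (phi Pi g).
  move=> /qL; rewrite LE => -[/MP[n Nn e] _]; apply: contrapT => nN.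
  by apply: (fS (phi Pi g) n) => //; exists v => //; exists g.
have ND n d : cns_set N n -> cns_set D d -> commute n d.
  by rewrite DE => Nn [/ZP Zd _]; rewrite /commute Zd.
have qD x : cns_set D x -> q x = 1 by rewrite DE => -[_ /qL].
have kerND x : q x = 1 -> exists n d, [/\ cns_set N n, cns_set D d & x = n * d].
  move=> /qL Lx; have : cns_set K x by move: Lx; rewrite LE => -[].
  move=> /KP[n Nn nx]; exists n, (n^-1 * x); split=> //; last by rewrite mulVKg.
  rewrite DE; split; first by apply/ZP => m Nm; exact: nx.
  by apply: cnsM => //; exact: cnsV (NL _ Nn).
have rangeN : exists v, N `<=` range (phi Pi (v := v)) by exists r; case: (Nv r).
have [s [sc sM sN1 sN sD]] :=
  exists_splitting hC hT.1.2 hq qs qN phiN rangeN kerND.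
have [J [h [qh gen]]] := kernel_generated hC hq qs qN phiN.
have [D' [U [qD' D'N oU UP]]] :=
  exists_complement hC hPi hq qs ND qN qD kerND sc sM sN1 sN sD qh gen.
have [Q [psi hpsi]] := quotient_exists D'.
have [[psiM psic] _ psiK psio] := hpsi.
exists Q, psi; split=> //.
  apply: (residually_pro_class hC).
  exact: (quotient_residually hC hPi (@cns_closed _ D') hpsi).
move=> v; split.
  (* An element of the vertex group in [D'] is killed by [q], hence lies in [N], and [D'] meets [N]
     trivially. *)
  move=> g g' /(hom_eq psiM)/psiK; rewrite -(homV (@phiM v)) -phiM => D'g.
  have e := D'N _ D'g (phiN _ _ (qD' _ D'g)).
  by apply: phiI; apply/(hom_eq (@phiM v)).
(* The preimage of the image of the vertex group is stable under right multiplication by [U], the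
   product of [N] and [D']: the vertex group contains [N], and [psi] kills [D']. *)
apply: psio; apply: (open_translates oU); first exact: cns1.
move=> x u [g _ gx] /UP[n [d [Nn Dd ->]]].
have [/(_ n Nn)[k _ kn] _] := Nv v.
exists (g * k) => //; rewrite phiM !psiM -gx kn.
by rewrite (iffRL (psiK d) Dd) mulg1.
Qed.

Theorem theorem6p6 (C : finite_group_class) (hC : closed_class C)
    (Gamma : finite_graph) (G : proC_graph C Gamma) (hG : commensurating G)
    (T : subgraph Gamma) (hT : maximal_subtree T)
    (Pi : fundamental_group G T) :
  tame Pi <->
  exists (Q : topGroupType) (psi : Pi -> Q),
    [/\ pro_class C Q,
        continuous_hom psi
      & forall v : vert Gamma,
          injective (fun g : vgroup G v => psi (phi Pi g)) /\
          open (range (fun g : vgroup G v => psi (phi Pi g)))].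
Proof.
split; first exact: tame_embedding.
by move=> [Q [psi [pQ hpsi hv]]]; exact: (embedding_tame hC hG hT pQ hpsi hv).
Qed.
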